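(* Let $G_1$ be a graph that is periodic at a vertex at time $2\pi$, and let $G_2\in\mathcal{G}$. Then the Cartesian product $G_1\square G_2$ admits pretty good state transfer. If, in addition, $G_1$ is regular, then the complement of $G_1\square G_2$ also exhibits pretty good state transfer.
   Context: Graphs are finite and simple. For a graph $G$ with adjacency matrix $A$, the transition matrix is $H(t)=\exp(-itA)$, $t\in\mathbb{R}$. For a vertex $u$, $e_u$ denotes the standard basis (column) vector indexed by $u$. The graph $G$ is periodic at a vertex $u$ at time $\tau\in\mathbb{R}$ if $H(\tau)e_u=\gamma e_u$ for some complex number $\gamma$ with $|\gamma|=1$. The graph $G$ admits (exhibits) pretty good state transfer between two distinct vertices $u$ and $v$ if there exist a sequence of real numbers $\{t_m\}$ and a complex number $\gamma$ with $|\gamma|=1$ such that $\lim_{m\to\infty}H(t_m)e_u=\gamma e_v$. The graph $G$ admits pretty good state transfer if it does so between some pair of distinct vertices. The cycle $C_n$ is the graph with vertex set $\mathbb{Z}_n$ in which $a,b$ are adjacent if and only if $a-b\in\{1,n-1\}$. A proper divisor of $n$ is a positive divisor $d<n$. For a proper divisor $d$ of $n$, let $S_n(d)=\{x\in\mathbb{Z}_n:\gcd(x,n)=d\}$, and for a (possibly empty) set $D$ of proper divisors of $n$ let $S_n(D)=\bigcup_{d\in D}S_n(d)$. The gcd graph $G(n,D)$ is the graph with vertex set $\mathbb{Z}_n$ in which $a,b$ are adjacent if and only if $a-b\in S_n(D)$. The graph $C_n\cup G(n,D)$ has vertex set $\mathbb{Z}_n$ and edge set the union of the edge sets of $C_n$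 and $G(n,D)$. For $k\ge 3$, $\mathcal{G}_k=\{C_{2^k}\cup G(2^k,D): D\text{ is a set of proper divisors of }2^k\text{ and }1\notin D\}$, $\bar{\mathcal{G}}_k$ is the set of complements of the graphs in $\mathcal{G}_k$, and $\mathcal{G}=\bigcup_{k\ge 3}(\mathcal{G}_k\cup\bar{\mathcal{G}}_k)$. The Cartesian product $G_1\square G_2$ of graphs with vertex sets $V_1,V_2$ has vertex set $V_1\times V_2$, with $(u_1,u_2)$ and $(v_1,v_2)$ adjacent if and only if either $u_1$ is adjacent to $v_1$ in $G_1$ and $u_2=v_2$, or $u_1=v_1$ and $u_2$ is adjacent to $v_2$ in $G_2$. *)

(* Defs.v *)
From HB Require Import structures.
From mathcomp Require Import all_boot all_order all_algebra.
From mathcomp Require Import all_classical all_reals all_analysis.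
From mathcomp Require Import complex.

Set Implicit Arguments.
Unset Strict Implicit.
Unset Printing Implicit Defensive.

Import Order.TTheory GRing.Theory Num.Theory.
Import numFieldNormedType.Exports.

Local Open Scope classical_set_scope.
Local Open Scope ring_scope.
Local Open Scope complex_scope.

Record sgraph (V : finType) := SGraph {
  adj : rel V;
  adj_sym : symmetric adj;
  adj_irr : irreflexive adj
}.

Section GraphOperations.
Variables V W : finType.
Implicit Types (G H : sgraph V) (K : sgraph W).

Definition regular G : Prop :=
  exists d : nat, forall x : V, #|[set y | adj G x y]%SET| = d.

Fact compl_sym G : symmetric (fun x y => (x != y) && ~~ adj G x y).
Proof. by move=> x y; rewrite eq_sym adj_sym. Qed.
Fact compl_irr G : irreflexive (fun x y => (x != y) && ~~ adj G x y).
Proof. by move=> x; rewrite eqxx. Qed.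
Definition compl_graph G : sgraph V := SGraph (compl_sym G) (compl_irr G).

Fact union_sym G H : symmetric (fun x y => adj G x y || adj H x y).
Proof. by move=> x y; rewrite adj_sym [adj H x y]adj_sym. Qed.
Fact union_irr G H : irreflexive (fun x y => adj G x y || adj H x y).
Proof. by move=> x; rewrite !adj_irr. Qed.
Definition union_graph G H : sgraph V :=
  SGraph (union_sym G H) (union_irr G H).

Definition cart_adj G K : rel (V * W) := fun x y =>
  (adj G x.1 y.1 && (x.2 == y.2)) || ((x.1 == y.1) && adj K x.2 y.2).
Fact cart_sym G K : symmetric (cart_adj G K).
Proof.
move=> x y; rewrite /cart_adj (adj_sym G x.1) (adj_sym K x.2).
by rewrite (eq_sym x.1) (eq_sym x.2).
Qed.
Fact cart_irr G K : irreflexive (cart_adj G K).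
Proof. by move=> x; rewrite /cart_adj !adj_irr andbF. Qed.
Definition cart_graph G K : sgraph (V * W)%type :=
  SGraph (cart_sym G K) (cart_irr G K).

End GraphOperations.

(* 'Z_n is the ring of integers modulo n only for n >= 2 ('Z_0 and 'Z_1 are
   Z/2); the graphs below are only meant for such n. *)

(* -1 is the residue of n - 1. *)
Definition cycle_adj (n : nat) : rel 'Z_n :=
  fun a b => (a - b == 1) || (a - b == -1).

Fact cycle_sym n : symmetric (@cycle_adj n).
Proof.
move=> a b; rewrite /cycle_adj -(opprB b a) -(inj_eq oppr_inj) opprK.
by rewrite (inj_eq oppr_inj) orbC.
Qed.
Fact cycle_irr n : irreflexive (@cycle_adj n).
Proof.
by move=> a; rewrite /cycle_adj subrr !(eq_sym 0) oppr_eq0 oner_eq0.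
Qed.
Definition cycle_graph (n : nat) : sgraph 'Z_n :=
  SGraph (@cycle_sym n) (@cycle_irr n).

(* Proper divisors of n are smaller than n, so sets of them are represented
   in {set 'I_n}. *)
Definition proper_divisors (n : nat) : {set 'I_n} := [set d : 'I_n | (d %| n)%N]%SET.

(* x is read as its representative in {0, ..., n - 1}; as gcdn 0 n = n, the
   class of a proper divisor does not contain 0. *)
Definition gcd_class (n d : nat) : {set 'Z_n} :=
  [set x : 'Z_n | gcdn x n == d]%SET.

Definition gcd_set (n : nat) (D : {set 'I_n}) : {set 'Z_n} :=
  (\bigcup_(d in D) gcd_class n d)%SET.

Definition gcd_adj (n : nat) (D : {set 'I_n}) : rel 'Z_n :=
  fun a b => a - b \in gcd_set D.

Fact gcd_classN n (d : 'I_n) (x : 'Z_n) :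
  x \in gcd_class n d -> - x \in gcd_class n d.
Proof.
case: n d x => [|[|n]] [d ltdn] x //; rewrite !inE //=.
  by move/eqP=> xd; move: ltdn; rewrite -xd gcdn1.
move/eqP=> <-; apply/eqP; rewrite gcdn_modl.
have lexn : (x <= n.+2)%N by rewrite ltnW.
apply/eqP; rewrite eqn_dvd !dvdn_gcd !dvdn_gcdr !andbT.
apply/andP; split.
  by rewrite -(dvdn_addr _ (dvdn_gcdl (n.+2 - x) n.+2)) subnK // dvdn_gcdr.
by rewrite dvdn_subr // ?dvdn_gcdl ?dvdn_gcdr.
Qed.
Fact gcd_sym n (D : {set 'I_n}) : symmetric (gcd_adj D).
Proof.
suff sub a b : gcd_adj D a b -> gcd_adj D b a.
  by move=> a b; apply/idP/idP; apply: sub.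
case/bigcupP=> d dD abd; apply/bigcupP; exists d => //.
by rewrite -opprB; apply: gcd_classN.
Qed.
Fact gcd_irr n (D : {set 'I_n}) : irreflexive (gcd_adj D).
Proof.
move=> a; apply/negP; rewrite /gcd_adj subrr => /bigcupP[d _].
by rewrite inE gcd0n => /eqP nd; have := ltn_ord d; rewrite -nd ltnn.
Qed.
Definition gcd_graph (n : nat) (D : {set 'I_n}) : sgraph 'Z_n :=
  SGraph (gcd_sym D) (gcd_irr D).

Definition Gfam (k : nat) (G : sgraph 'Z_(2 ^ k)) : Prop :=
  exists D : {set 'I_(2 ^ k)},
    [/\ D \subset proper_divisors (2 ^ k),
        forall d, d \in D -> d <> 1%N :> nat
      & G = union_graph (cycle_graph (2 ^ k)) (gcd_graph D)].

Definition Gfam_compl (k : nat) (G : sgraph 'Z_(2 ^ k)) : Prop :=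
  exists2 H : sgraph 'Z_(2 ^ k), Gfam H & G = compl_graph H.

Inductive in_calG : forall V : finType, sgraph V -> Prop :=
| InCalG (k : nat) (G : sgraph 'Z_(2 ^ k)) :
    (3 <= k)%N -> Gfam G \/ Gfam_compl G -> in_calG G.

(* R[i] as an abstract numClosedFieldType, so that the topology of numeric
   fields, hence that of matrices over them, is inferred. *)
Definition complexField (R : realType) : numClosedFieldType := R[i].

Definition expmx (C : numFieldType) (n : nat) (M : 'M[C]_n) : 'M[C]_n :=
  lim (series (fun k => (k`!%:R)^-1 *: M ^+ k) @ \oo).

Section QuantumWalk.
Variables (R : realType) (V : finType).
Implicit Types (G : sgraph V) (u v : V) (t : R).
Local Notation C := (complexField R).

(* Matrices are indexed by 'I_#|V|, through enum_val and enum_rank. *)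
Definition adjmx G : 'M[C]_#|V| :=
  \matrix_(i, j) (adj G (enum_val i) (enum_val j))%:R.

Definition basis_vec u : 'cV[C]_#|V| := delta_mx (enum_rank u) 0.

Definition transition G t : 'M[C]_#|V| :=
  expmx (- ('i * t%:C : C) *: adjmx G).

Definition periodic_at G u t : Prop :=
  exists gamma : C,
    `|gamma| = 1 /\ transition G t *m basis_vec u = gamma *: basis_vec u.

Definition pgst_between G u v : Prop :=
  u <> v /\
  exists (t : nat -> R) (gamma : C), `|gamma| = 1 /\
    (fun m => transition G (t m) *m basis_vec u) @ \oo --> gamma *: basis_vec v.

Definition pgst G : Prop := exists u v : V, pgst_between G u v.

End QuantumWalk.

(* Main.v *)
(** Times are restricted to integer multiples of 2 pi, at which the integer
parts of the eigenvalues are invisible. Every graph of G_k is circulant on Z_n,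
n = 2^k, with characters as eigenfunctions and eigenvalues
2 cos (2 pi j / n) + (an integer), because the Ramanujan sums contributed by the
gcd graph are integers. The numbers 1 and 2 cos (2 pi j / n), 0 < j < n / 4, are
linearly independent over Q since X^(n/2) + 1 is irreducible, so Kronecker's
theorem gives integers m such that 2 m cos (2 pi j / n) is close to j / 2
modulo 1 for these j, hence for all j by symmetry: along the times 2 pi m the
walk transfers 0 to n / 2 with phase 1. In the Cartesian product the periodic
factor only contributes a phase gamma^m, which converges along a subsequence.
For complements of regular graphs, the transition matrix at 2 pi m is the one of
the original graph at -2 pi m, and all of the above works at negative times. *)

Require Import Defs.
From mathcomp Require Import all_boot all_order all_algebra.
From mathcomp Require Import all_classical all_reals all_analysis.
From mathcomp Require Import complex ring lra zify.

Set Implicit Arguments.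
Unset Strict Implicit.
Unset Printing Implicit Defensive.

Import Order.TTheory GRing.Theory Num.Theory.
Import numFieldNormedType.Exports.

Local Open Scope classical_set_scope.
Local Open Scope ring_scope.
Local Open Scope complex_scope.

(** * Kronecker's theorem *)

(** From p to p + 1 the right-hand side grows by the factor 2 (2p + 3) / (p + 1), which is at least
    4. *)
Lemma central_bin_ge (p : nat) : (4 ^ p <= (2 * p).+1 * 'C(2 * p, p))%N.
Proof.
elim: p => [//|p IH].
have e1 : ((2 * p).+2 * 'C((2 * p).+1, p) = p.+1 * 'C((2 * p).+2, p.+1))%N.
  by rewrite -mul_bin_diag.
have e2 : ((2 * p).+1 * 'C(2 * p, p) = p.+1 * 'C((2 * p).+1, p))%N.
  by rewrite mul_bin_down; congr (_ * _)%N; lia.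
rewrite (_ : 2 * p.+1 = (2 * p).+2)%N; last by lia.
rewrite expnS; nia.
Qed.

Section Mean.
Variable R : realType.
Local Notation C := (complexField R).
Implicit Types (f g : nat -> C) (c d : C).

(* An O(1 / T) rate of convergence of the averages, which spares all limits. *)
Definition has_mean f c :=
  exists K : C, forall T, `|\sum_(0 <= m < T) f m - T%:R * c| <= K.

Lemma has_mean_ext f g c : f =1 g -> has_mean f c -> has_mean g c.
Proof. by move=> /funext ->. Qed.

Lemma has_meanZ a f c : has_mean f c -> has_mean (fun m => a * f m) (a * c).
Proof.
move=> [K fK]; exists (`|a| * K) => T.
by rewrite -mulr_sumr mulrCA -mulrBr normrM ler_wpM2l.
Qed.

Lemma has_mean_sum (I : finType) (f : I -> nat -> C) (c : I -> C) :
  (forall i, has_mean (f i) (c i)) ->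
  has_mean (fun m => \sum_i f i m) (\sum_i c i).
Proof.
move=> /choice[K fK]; exists (\sum_i K i) => T.
rewrite exchange_big/= mulr_sumr -sumrB.
by apply: le_trans (ler_norm_sum _ _ _) _; apply: ler_sum.
Qed.

(** Geometric sums of ratio z != 1 on the unit circle stay bounded by 2 / |z - 1|. *)
Lemma has_mean_exp (z : C) : `|z| = 1 -> has_mean (fun m => z ^+ m) (z == 1)%:R.
Proof.
move=> z1; have [->|zN1] := eqVneq z 1.
  exists 0 => T; under eq_bigr do rewrite expr1n.
  by rewrite big_const_nat subn0 iter_addr_0 mulr1 subrr normr0.
exists (2 / `|z - 1|) => T.
rewrite mulr0 subr0 ler_pdivlMr ?normr_gt0 ?subr_eq0// -normrM mulrC.
rewrite big_mkord -subrX1 (le_trans (ler_normB _ _))//.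
by rewrite normrX z1 expr1n normr1.
Qed.

Lemma archi_complex (x K : C) : 0 <= x -> (forall T : nat, T%:R * x <= K) -> x <= 0.
Proof.
move=> x0 xK; have K0 : 0 <= K by have := xK 0%N; rewrite mul0r.
move: x0 xK K0; case: x => a a'; case: K => b b'.
rewrite !lecE/= => /andP[/eqP -> a0] ab /andP[/eqP b'0 b0]; subst b'.
rewrite eqxx /= leNgt; apply/negP => {}a0.
have /= := ab (Num.bound (b / a)).
rewrite (_ : (_%:R : C) = (Num.bound (b / a))%:R%:C); last by rewrite rmorph_nat.
have -> : (a +i* 0 : C) = a%:C by [].
have -> : (b +i* 0 : C) = b%:C by [].
rewrite -rmorphM lecR leNgt => /negP; apply.
by rewrite -ltr_pdivrMr// archi_boundP// divr_ge0// ltW.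
Qed.

(** If d < c, the numbers T (c - d) would stay below the sum of the two error bounds for every T. *)
Lemma has_mean_le f g c d : has_mean f c -> has_mean g d ->
  (forall m, f m <= g m) -> c \is Num.real -> d \is Num.real -> c <= d.
Proof.
move=> [K fK] [L gL] fg cr dr; rewrite real_leNgt//; apply/negP => dc.
have : c - d <= 0.
  apply: (@archi_complex _ (K + L)) => [|T]; first by rewrite subr_ge0 ltW.
  have fgT : \sum_(0 <= m < T) f m <= \sum_(0 <= m < T) g m by apply: ler_sum.
  have Td : 0 <= T%:R * (c - d) by rewrite mulr_ge0// subr_ge0 ltW.
  set F := \sum_(0 <= m < T) f m in fgT *; set G := \sum_(0 <= m < T) g m in fgT *.
  have FG : 0 <= G - F by rewrite subr_ge0.
  have e : T%:R * (c - d) + (G - F) = (G - T%:R * d) - (F - T%:R * c) by ring.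
  apply: (@le_trans _ _ (T%:R * (c - d) + (G - F))); first by rewrite lerDl.
  have /ger0_norm <- := addr_ge0 Td FG.
  rewrite e.
  apply: (le_trans (ler_normB _ _)); rewrite [K + L]addrC.
  by apply: lerD; [exact: gL|exact: fK].
by rewrite subr_le0 real_leNgt// dc.
Qed.

End Mean.

(** Since 2 + z + z^-1 = (1 + z)^2 / z, this is the binomial theorem. Terms with l > 2p vanish; the
    free bound [L] lets factors with different p share one index type. *)
Lemma cos_kernel_expand (F : fieldType) (z : F) (p L : nat) : z != 0 -> (2 * p < L)%N ->
  (2 + z + z^-1) ^+ p = \sum_(l < L) 'C(2 * p, l)%:R * z ^ (l%:Z - p%:Z).
Proof.
move=> z0 pL.
have -> : 2 + z + z^-1 = (1 + z) ^+ 2 / z by field.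
rewrite expr_div_n -exprM exprDn mulr_suml.
rewrite (big_ord_widen L (fun i => (1 ^+ (2 * p - i) * z ^+ i *+ 'C(2 * p, i)) / z ^+ p)) //.
rewrite big_mkcond/=; apply: eq_bigr => l _.
rewrite expr1n mul1r expfzDr// -exprnN -mulr_natl -mulrA.
by rewrite ltnS; case: leqP => // lp; rewrite bin_small// !mul0r.
Qed.

Lemma bernoulli_ineq (F : realFieldType) (h : F) (n : nat) :
  0 <= h -> 1 + n%:R * h <= (1 + h) ^+ n.
Proof.
move=> h0; elim: n => [|n IH]; first by rewrite mul0r addr0.
rewrite exprS (le_trans _ (ler_wpM2l _ IH)) ?addr_ge0//.
rewrite -(natr1 n); have : 0 <= n%:R * h * h by rewrite !mulr_ge0.
nra.
Qed.

(** Write rho = 1 / (1 + h). An even exponent p = 2s makes rho^-p at least (1 + s h)^2 by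
    Bernoulli's inequality, which is quadratic in s and beats (4s + 1) n <= 5 s n once 5 n < s
    h^2. *)
Lemma linear_lt_geometric (F : archiRealFieldType) (rho : F) (n : nat) :
  0 < rho < 1 -> exists p : nat, (2 * p).+1%:R * n%:R * rho ^+ p < 1.
Proof.
move=> /andP[r0 r1]; pose h := rho^-1 - 1.
have h0 : 0 < h by rewrite subr_gt0 invf_gt1.
pose s := (Num.bound (5 * n%:R / h ^+ 2)).+1.
exists (2 * s)%N.
have hs : 5 * n%:R < s%:R * h ^+ 2.
  rewrite -ltr_pdivrMr ?exprn_gt0// (lt_trans (archi_boundP _))//.
    by rewrite divr_ge0// ?exprn_ge0 ?mulr_ge0// ltW.
  by rewrite ltr_nat.
have -> : rho ^+ (2 * s) = ((1 + h) ^+ s) ^- 2.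
  by rewrite /h addrC subrK mulnC exprM exprVn -exprVn invrK.
have b := @bernoulli_ineq _ h s (ltW h0).
have b0 : 0 < (1 + h) ^+ s by rewrite exprn_gt0// addr_gt0.
rewrite ltr_pdivrMr ?mul1r; last exact: exprn_gt0.
have sh0 : 0 <= s%:R * h by rewrite mulr_ge0// ltW.
have : (1 + s%:R * h) ^+ 2 <= ((1 + h) ^+ s) ^+ 2.
  by rewrite ler_pXn2r// nnegrE ?addr_ge0// ltW.
apply: lt_le_trans.
have s1 : 1 <= s%:R :> F by rewrite ler1n.
have -> : (2 * (2 * s)).+1%:R = 4 * s%:R + 1 :> F by rewrite mulnA -natr1 natrM.
have n0 : 0 <= n%:R :> F by [].
have : s%:R * (5 * n%:R) < s%:R * (s%:R * h ^+ 2).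
  by rewrite ltr_pM2l// (lt_le_trans _ s1).
nra.
Qed.

(** On the unit circle z^-1 is the conjugate of z. The kernel is thus at most 4, and close to 4 only
    when z is close to 1. *)
Lemma cos_kernel_norm (C : numClosedFieldType) (z : C) :
  `|z| = 1 -> 2 + z + z^-1 = 4 - `|z - 1| ^+ 2.
Proof.
move=> z1; have z0 : z != 0 by rewrite -normr_gt0 z1.
have zV : z^-1 = (z^*)%R by rewrite invC_norm z1 expr1n invr1 mul1r.
by rewrite normCK rmorphB rmorph1/= -zV; field.
Qed.

Section Kronecker.
Variables (R : realType) (I : finType).
Local Notation C := (complexField R).
Variables w a : I -> C.
Hypotheses (w1 : forall i, `|w i| = 1) (a1 : forall i, `|a i| = 1).
Hypothesis w_indep :
  forall l : I -> int, \prod_i w i ^ l i = 1 -> forall i, l i = 0.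

Let z i m := w i ^+ m / a i.
Let w0 i : w i != 0. Proof. by rewrite -normr_gt0 w1. Qed.
Let a0 i : a i != 0. Proof. by rewrite -normr_gt0 a1. Qed.

(** The expanded product is a finite sum of terms c W^m, where W is a product of integer powers of
    the [w i]. By independence W = 1 only when all exponents vanish, so only the product of central
    binomial coefficients survives in the mean. *)
Lemma cos_kernel_mean (p : I -> nat) :
  has_mean (fun m => \prod_i (2 + z i m + (z i m)^-1) ^+ p i)
    (\prod_i 'C(2 * p i, p i)%:R).
Proof.
pose L := (\sum_i 2 * p i).+1.
have pL i : (2 * p i < L)%N by rewrite ltnS (bigD1 i)//= leq_addr.
pose W (phi : {ffun I -> 'I_L}) := \prod_i w i ^ ((phi i)%:Z - (p i)%:Z).
pose c (phi : {ffun I -> 'I_L}) :=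
  \prod_i ('C(2 * p i, phi i)%:R * (a i)^-1 ^ ((phi i)%:Z - (p i)%:Z)).
apply: (@has_mean_ext _ (fun m => \sum_phi c phi * W phi ^+ m)) => [m|].
  under [RHS]eq_bigr => i _ do
    rewrite (cos_kernel_expand _ (pL i)) ?mulf_neq0 ?expf_neq0 ?invr_neq0//.
  rewrite bigA_distr_bigA/=; apply: eq_bigr => phi _.
  rewrite -prodrXl -big_split/=; apply: eq_bigr => i _.
  rewrite /z exprzMl ?unitfE ?expf_neq0 ?invr_neq0// -mulrA.
  have -> (e : int) : (w i ^+ m) ^ e = (w i ^ e) ^+ m := exprzAC (w i) m e.
  by congr (_ * _); exact: mulrC.
have -> : \prod_i 'C(2 * p i, p i)%:R = \sum_phi c phi * (W phi == 1)%:R.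
  pose q : {ffun I -> 'I_L} := [ffun i =>
    Ordinal (leq_ltn_trans (leq_pmull (p i) (isT : 0 < 2)%N) (pL i))].
  rewrite (bigD1 q)//= [X in _ + X]big1 => [|phi phiq].
    have -> : W q = 1 by rewrite /W big1// => i _; rewrite ffunE subrr expr0z.
    rewrite eqxx mulr1 addr0.
    by apply: eq_bigr => i _; rewrite ffunE/= subrr expr0z mulr1.
  case: eqP => [/w_indep phi0|]; last by rewrite mulr0.
  case/eqP: phiq; apply/ffunP => i; apply: val_inj; rewrite ffunE/=.
  by have /eqP := phi0 i; rewrite subr_eq0 => /eqP[].
apply: has_mean_sum => phi; apply/has_meanZ/has_mean_exp.
rewrite normr_prod big1// => i _.
case: (_ - _)%R => n; first by rewrite normrX w1 expr1n.
by rewrite NegzE -exprnN normrV ?unitfE ?expf_neq0// normrX w1 expr1n invr1.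
Qed.

(* If every m missed the target, some factor q_i would be at most r < 4 at each
   m, so prod_i q_i^p <= sum_j r^p prod_(i <> j) q_i^p. Taking means gives
   'C(2p, p) <= #|I| r^p for all p, although 'C(2p, p) >= 4^p / (2p + 1). *)
Theorem kronecker (e : R) : 0 < e -> exists m, forall i, `|w i ^+ m - a i| < e%:C.
Proof.
move=> e0; apply: contrapT => /forallNP bad.
(* Capping the distance at 1 keeps r = 4 - d^2 positive. *)
pose d := Num.min e 1.
have d01 : 0 < d <= 1 by rewrite /d lt_min e0 ltr01/= ge_min lexx orbT.
have {}bad m : exists i, d%:C <= `|w i ^+ m - a i|.
  have /existsNP[i /negP wi] := bad m; exists i.
  have : e%:C <= `|w i ^+ m - a i|.
    by rewrite real_leNgt ?normr_real// complex_real.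
  by apply: le_trans; rewrite lecR ge_min lexx.
have z1 i m : `|z i m| = 1 by rewrite normrM normrX normfV w1 a1 expr1n divr1.
pose q i m := 2 + z i m + (z i m)^-1.
have qE i m : q i m = 4 - `|w i ^+ m - a i| ^+ 2.
  rewrite /q cos_kernel_norm//; congr (_ - _ ^+ 2).
  by rewrite -[LHS]mulr1 -[X in _ * X](a1 i) -normrM mulrBl mul1r divfK.
have q0 i m : 0 <= q i m.
  rewrite qE subr_ge0 (_ : 4 = 2 ^+ 2); last by rewrite expr2; ring.
  rewrite ler_pXn2r ?nnegrE// (le_trans (ler_normB _ _))// normrX w1 a1 expr1n.
  by rewrite -[1 + 1]/(2%:R).
pose r := 4 - d ^+ 2.
have r0 : 0 < r < 4 by rewrite /r; nra.
have qbad m : exists i, q i m <= r%:C.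
  have [i di] := bad m; exists i; rewrite qE rmorphB rmorphXn/= rmorph_nat lerB//.
  by rewrite ler_pXn2r ?nnegrE// ler0c ltW//; case/andP: d01.
(* The failure at time 0 provides an index, so [#|I|] is positive and its predecessor is
   meaningful. *)
have [i0 _] := bad 0%N.
have main p : ('C(2 * p, p)%:R <= #|I|%:R * r ^+ p).
  pose B : C := 'C(2 * p, p)%:R.
  have B0 : 0 < B by rewrite ltr0n bin_gt0; lia.
  have meanI := cos_kernel_mean (fun=> p).
  (* Exponent 0 at j removes the factor of j from the product. *)
  have meanD (j : I) := cos_kernel_mean (fun i => if i == j then 0%N else p).
  have meanS := has_mean_sum (fun j => has_meanZ (r%:C ^+ p) (meanD j)).
  have BD (j : I) : \prod_i ('C(2 * (if i == j then 0 else p), if i == j then 0 else p))%:R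
     = B ^+ #|I|.-1.
    rewrite (bigD1 j)//= eqxx muln0 bin0 mul1r (eq_bigr (fun=> B)) => [|i /negPf->//].
    by rewrite -(cardC1 j) -prodr_const; apply: eq_bigl => i; rewrite inE.
  have rC0 : 0 <= r%:C :> C by rewrite ler0c ltW//; case/andP: r0.
  have B0' : 0 <= B by exact: ltW.
  have := has_mean_le meanI meanS; rewrite (eq_bigr _ (fun j _ => congr1 _ (BD j))).
  rewrite prodr_const sumr_const -/B -[r%:C ^+ p * _ *+ _]mulr_natl => BI.
  have : B ^+ #|I| <= #|I|%:R * (r%:C ^+ p * B ^+ #|I|.-1).
    apply: BI => [m||]; rewrite ?ger0_real ?mulr_ge0 ?exprn_ge0//.
    have [j qj] := qbad m.
    rewrite (bigD1 j)//= [leRHS](bigD1 j)//= -/(q _ _).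
    rewrite [X in _ <= _ * X + _](bigD1 j)//= eqxx expr0 mul1r.
    rewrite -[leLHS]addr0 lerD//.
      apply: ler_pM.
      - exact/exprn_ge0/q0.
      - by apply: prodr_ge0 => i _; apply/exprn_ge0/q0.
      - by apply: lerXn2r => //; rewrite nnegrE// q0.
      - by apply: ler_prod => i /negPf ->; rewrite lexx andbT exprn_ge0// q0.
    apply: sumr_ge0 => i _; rewrite mulr_ge0 ?exprn_ge0//.
    by apply: prodr_ge0 => i' _; apply/exprn_ge0/q0.
  have {1 2}-> : #|I| = #|I|.-1.+1 by rewrite prednK//; apply/card_gt0P; exists i0.
  rewrite exprS mulrA ler_pM2r ?exprn_gt0// => {}BI.
  by rewrite -lecR rmorphM rmorphXn !rmorph_nat (le_trans BI)// prednK//;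
    apply/card_gt0P; exists i0.
(* The bounds 4^p / (2p + 1) <= 'C(2p, p) <= [#|I|] r^p would give 1 <= (2p + 1) [#|I|] rho^p for
   all p, although rho < 1. *)
pose rho := r / 4.
have [|p] := @linear_lt_geometric _ rho #|I|.
  by rewrite /rho; lra.
rewrite ltNge => /negP; apply.
rewrite expr_div_n mulrA ler_pdivlMr ?exprn_gt0// mul1r -natrX.
rewrite (le_trans _ (_ : (2 * p).+1%:R * 'C(2 * p, p)%:R <= _))//.
  by rewrite -natrM ler_nat central_bin_ge.
by rewrite -mulrA ler_wpM2l.
Qed.

End Kronecker.

(** * Rational independence of the cosines *)

(** As i 'C(2^b, i) = 2^b 'C(2^b - 1, i - 1), an odd 'C(2^b, i) would force 2^b to divide i. *)
Lemma even_bin_pow2 (b i : nat) : (0 < i < 2 ^ b)%N -> ~~ odd 'C(2 ^ b, i).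
Proof.
case: i => [//|i] /= ib; apply: contraL ib => oC; rewrite -leqNgt dvdn_leq//.
rewrite -(@Gauss_dvdl _ _ 'C(2 ^ b, i.+1)); last by rewrite coprimeXl// coprime2n.
by rewrite -mul_bin_diag dvdn_mulr.
Qed.

(* X^(2^b) + 1 shifted by 1, for Eisenstein's criterion at 2. *)
Definition shifted_cyclotomic (b : nat) : {poly int} := (1 + 'X) ^+ (2 ^ b) + 1.

Lemma shifted_cyclotomicE (b : nat) : shifted_cyclotomic b =
  \poly_(i < (2 ^ b).+1) ('C(2 ^ b, i) + (i == 0))%:R.
Proof.
rewrite /shifted_cyclotomic exprDn poly_def.
under [RHS]eq_bigr do rewrite natrD scalerDl.
rewrite big_split/=; congr (_ + _).
  by apply: eq_bigr => i _; rewrite expr1n mul1r scaler_nat.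
rewrite big_ord_recl/= scale1r expr0 big1 ?addr0// => i _; exact: scale0r.
Qed.

(** Eisenstein at 2: the leading coefficient is 1, the inner ones are even binomial coefficients,
    and the constant one is 2, not divisible by 4. *)
Lemma shifted_cyclotomic_irreducible (b : nat) : (0 < b)%N ->
  irreducible_poly (map_poly (intr : int -> rat) (shifted_cyclotomic b)).
Proof.
move=> b0; apply/irreducible_rat_int.
have b1 : (1 < 2 ^ b)%N by rewrite -{1}(expn0 2) ltn_exp2l.
have sq : size (shifted_cyclotomic b) = (2 ^ b).+1.
  by rewrite shifted_cyclotomicE size_poly_eq// binn eqn0Ngt expn_gt0.
have cq i : (i <= 2 ^ b)%N ->
    (shifted_cyclotomic b)`_i = ('C(2 ^ b, i) + (i == 0))%:R.
  by move=> ib; rewrite shifted_cyclotomicE coef_poly ltnS ib.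
apply: (@eisenstein_crit 2) => //; rewrite ?sq//.
- by rewrite eqSS -lt0n expn_gt0.
- by rewrite lead_coefE sq cq//= binn eqn0Ngt expn_gt0.
- by rewrite cq// bin0.
move=> i ib; rewrite cq; last exact: ltnW.
case: i ib => [|i] ib.
  rewrite bin0; exact: dvdzz.
rewrite addn0 natz dvdzE/= dvdn2.
exact: even_bin_pow2.
Qed.

(** After the shift by 1, z - 1 is a common root of f(1 + X) and of the irreducible
    [shifted_cyclotomic b]. A nonzero f has too small a degree to be divisible by the latter, so the
    two would be coprime. *)
Lemma pow2_root_degree (F : numFieldType) (z : F) (b : nat) (f : {poly int}) :
  (0 < b)%N -> z ^+ (2 ^ b) = -1 -> (size f <= 2 ^ b)%N ->
  root (map_poly intr f) z -> f = 0.
Proof.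
move=> b0 zb sf fz; apply/eqP; apply: contraT => f0.
pose q : {poly rat} := map_poly intr (shifted_cyclotomic b).
pose g : {poly rat} := map_poly intr f \Po (1 + 'X).
have sX : size (1 + 'X : {poly rat}) = 2%N.
  by rewrite addrC size_polyDl size_polyX// size_poly1.
have sq : size q = (2 ^ b).+1.
  rewrite /q size_map_inj_poly//; last exact: intr_inj.
  by rewrite shifted_cyclotomicE size_poly_eq// binn eqn0Ngt expn_gt0.
have sg : size g = size f.
  by rewrite size_comp_poly2// size_map_inj_poly//; apply: intr_inj.
have g0 : g != 0 by rewrite -size_poly_gt0 sg size_poly_gt0.
have cqg : coprimep q g.
  rewrite irreducible_poly_coprime; last exact: shifted_cyclotomic_irreducible.
  by apply/negP => /(dvdp_leq g0); rewrite sq sg leqNgt ltnS sf.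
have ratr_intr (p : {poly int}) :
    map_poly (ratr : rat -> F) (map_poly intr p) = map_poly intr p.
  by rewrite -map_poly_comp; apply: eq_map_poly => x /=; rewrite ratr_int.
have : coprimep (map_poly ratr q) (map_poly (ratr : rat -> F) g).
  by rewrite coprimep_map.
move=> /coprimep_root/(_ (_ : root _ (z - 1))) => /(_ _)/negP; case.
  rewrite /q ratr_intr /root /shifted_cyclotomic rmorphD rmorphXn rmorphD !rmorph1/=.
  by rewrite map_polyX !hornerE/= addrAC subrr add0r zb addNr.
rewrite /g map_comp_poly ratr_intr rmorphD/= rmorph1 map_polyX horner_comp !hornerE.
by rewrite /= addrAC subrr add0r.
Qed.

(* Multiplied by z^(2^c), the relation becomes a polynomial one of degree less
   than 2^(c+1). *)
Lemma two_cos_independent (F : numFieldType) (z : F) (c : nat)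
    (l : 'I_(2 ^ c).-1 -> int) (l0 : int) : z ^+ (2 ^ c.+1) = -1 ->
  \sum_i (l i)%:~R * (z ^+ i.+1 + z ^- i.+1) = l0%:~R -> forall i, l i = 0.
Proof.
move=> zc; set N := (2 ^ c)%N in l *; move=> lsum i0.
have z0 : z != 0.
  apply: contra_eq_neq zc => ->; rewrite expr0n expn_eq0/= eq_sym oppr_eq0.
  by rewrite oner_eq0.
have iN (i : 'I_N.-1) : (i.+1 < N)%N by case: i => i /=; lia.
pose f : {poly int} := \sum_i l i *: ('X^(N + i.+1) + 'X^(N - i.+1)) - l0 *: 'X^N.
have fE k : f`_k = \sum_i l i * ((k == N + i.+1)%N%:R + (k == N - i.+1)%N%:R)
   - l0 * (k == N)%:R.
  rewrite coefB coef_sum coefZ coefXn; congr (_ - _).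
  by apply: eq_bigr => i _; rewrite coefZ coefD !coefXn.
have f0 : f = 0.
  apply: (@pow2_root_degree _ z c.+1) => //.
    apply/leq_sizeP => k; rewrite expnS -/N => Nk; rewrite fE.
    have i0N := iN i0.
    rewrite (_ : k == N = false) ?mulr0 ?subr0; last by lia.
    apply: big1 => i _; have := iN i => ?.
    have -> : (k == N + i.+1)%N = false by lia.
    have -> : (k == N - i.+1)%N = false by lia.
    by rewrite addr0 mulr0.
  rewrite /root /f rmorphB/= rmorph_sum/= hornerD hornerN horner_sum.
  rewrite map_polyZ/= map_polyXn !hornerE -lsum mulr_suml subr_eq0.
  apply/eqP/eq_bigr => i _; rewrite map_polyZ rmorphD/= !map_polyXn !hornerE -mulrA.
  congr (_ * _); rewrite mulrDl exprD; congr (_ + _); first exact: mulrC.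
  have -> : z ^+ N = z ^+ (N - i.+1) * z ^+ i.+1 by rewrite -exprD subnK// ltnW.
  by rewrite mulrCA mulVf ?mulr1 ?expf_neq0.
(* The exponents N + i + 1 are distinct and exceed N and all N - i - 1, so this coefficient is
   exactly [l i0]. *)
have : f`_(N + i0.+1) = 0 by rewrite f0 coef0.
rewrite fE; have i0N := iN i0.
rewrite (_ : (N + i0.+1 == N)%N = false) ?mulr0 ?subr0; last by lia.
rewrite (bigD1 i0)//= big1 => [|i ii0].
  rewrite eqxx (_ : (_ == N - _)%N = false) ?addr0 ?mulr1//; lia.
have ? : (i == i0 :> nat) = false by apply: negbTE.
have -> : (N + i0.+1 == N + i.+1)%N = false by lia.
have -> : (N + i0.+1 == N - i.+1)%N = false by lia.
by rewrite addr0 mulr0.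
Qed.

(** * Matrix exponentials and walks *)

Lemma cvg_sum_fin (K : numFieldType) (I : finType) (u : I -> nat -> K) (l : I -> K) :
  (forall i, u i @ \oo --> l i) -> (fun n => \sum_i u i n) @ \oo --> \sum_i l i.
Proof.
move=> ul; rewrite (_ : (fun n => _) = \sum_i u i); last first.
  by apply/funext => n; rewrite fct_sumE.
rewrite !unlock; elim: (index_enum I) => [|i s IH] /=; first exact: cvg_cst.
exact: cvgD.
Qed.

Lemma cvg_mx (K : numFieldType) p q (A : nat -> 'M[K]_(p, q)) (L : 'M[K]_(p, q)) :
  (forall i j, (fun n => A n i j) @ \oo --> L i j) -> A @ \oo --> L.
Proof.
move=> AL X [P LP PX].
suff : \forall n \near \oo, forall i j, P i j (A n i j).
  by apply: filterS => n; apply: PX.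
apply: filter_forall => i; apply: filter_forall => j; exact: AL (LP i j).
Qed.

Lemma limn_mx (K : numFieldType) p q (A : nat -> 'M[K]_(p, q)) (L : 'M[K]_(p, q)) :
  A @ \oo --> L -> limn A = L.
Proof.
move=> AL; have cA : cvgn A by apply/cvg_ex; exists L.
apply/matrixP => i j.
have e (M : 'M[K]_(p, q)) : A @ \oo --> M -> (fun n => A n i j) @ \oo --> (fun_of_matrix M i j).
  by move=> AM; apply: (@cvg_comp _ _ _ A (fun N : 'M[K]_(p, q) => N i j) _ _ _ AM);
    exact: coord_continuous.
by apply: (cvg_unique (@norm_hausdorff _ K^o) (e _ cA) (e _ AL)).
Qed.

(** * The unit circle and its exponential series *)

Section Cis.
Variable R : realType.
Local Notation C := (complexField R).

(** This is exp(i x), given by coordinates so that real trigonometry applies; [cvg_cis] identifies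
    it with the exponential series. *)
Definition cis (x : R) : C := (cos x +i* sin x)%C.

Lemma cisD x y : cis (x + y) = cis x * cis y.
Proof. by rewrite /cis cosD sinD; congr (_ +i* _)%C; ring. Qed.

Lemma cis0 : cis 0 = 1.
Proof. by rewrite /cis cos0 sin0. Qed.

Lemma norm_cis x : `|cis x| = 1.
Proof. by rewrite normc_def/= cos2Dsin2 sqrtr1. Qed.

Lemma cis_neq0 x : cis x != 0.
Proof. by rewrite -normr_gt0 norm_cis. Qed.

Lemma cisN x : cis (- x) = (cis x)^-1.
Proof.
by apply: (mulIf (cis_neq0 x)); rewrite mulVf ?cis_neq0// -cisD addNr cis0.
Qed.

Lemma cisMn x n : cis (x *+ n) = cis x ^+ n.
Proof. by elim: n => [|n IH]; rewrite ?cis0// mulrS cisD IH exprS. Qed.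

Lemma cisM_nat (x : R) (n : nat) : cis (x * n%:R) = cis x ^+ n.
Proof. by rewrite mulr_natr cisMn. Qed.

Lemma cisMz x (n : int) : cis (x * n%:~R) = cis x ^ n.
Proof.
case: n => n; first by rewrite -pmulrn mulr_natr cisMn.
by rewrite NegzE mulrNz mulrN cisN -pmulrn mulr_natr cisMn exprnN.
Qed.

Lemma cis_sum (I : finType) (x : I -> R) : cis (\sum_i x i) = \prod_i cis (x i).
Proof. exact: (big_morph cis cisD cis0). Qed.

Lemma cis_pi : cis pi = -1.
Proof. by rewrite /cis cospi sinpi; apply/eqP; rewrite eq_complex/= oppr0 !eqxx. Qed.

Lemma cis_2pi : cis (2 * pi) = 1.
Proof. by rewrite mulr_natl cisMn cis_pi sqrrN expr1n. Qed.

Lemma cis_2pi_int (n : int) : cis (2 * pi * n%:~R) = 1.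
Proof. by rewrite cisMz cis_2pi exp1rz. Qed.

Lemma cis_root (n j : nat) : (0 < n)%N -> cis (2 * pi / n%:R * j%:R : R) ^+ n = 1.
Proof.
move=> n0; rewrite -cisM_nat mulrAC divfK; first exact: (cis_2pi_int j%:Z).
by rewrite pnatr_eq0 -lt0n.
Qed.

(** Subtracting the multiple of 2 pi found by the floor leaves y in [0, 2 pi) with cos y = 1, and y
    must be 0. *)
Lemma cis_eq1 x : cis x = 1 -> exists n : int, x = 2 * pi * n%:~R.
Proof.
have pi0 := @pi_gt0 R; have pi20 : 0 < 2 * pi :> R by rewrite mulr_gt0.
move=> x1; exists (Num.floor (x / (2 * pi))); set n := Num.floor _.
pose y := x - 2 * pi * n%:~R.
have y1 : cis y = 1 by rewrite /y cisD cisN cis_2pi_int x1 invr1 mulr1.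
have y0 : 0 <= y.
  rewrite subr_ge0 mulrC -ler_pdivlMr//; exact: floor_le_tmp.
have y2 : y < 2 * pi.
  have e : 2 * pi + 2 * pi * n%:~R = (n + 1)%:~R * (2 * pi) :> R.
    by rewrite intrD; ring.
  by rewrite ltrBlDr e -ltr_pdivrMr// floorD1_gt// num_real.
suff : y = 0 by move/eqP; rewrite subr_eq0 => /eqP.
have cos_eq1 t : 0 <= t <= pi -> cos t = 1 -> t = 0.
  by move=> t0 t1; apply: cos_inj; rewrite ?in_itv/= ?t0 ?lexx ?pi_ge0 ?t1 ?cos0.
have cy : cos y = 1 by case: y1.
have [ypi|ypi] := lerP y pi; first by apply: cos_eq1 => //; rewrite y0.
(* Cosine is injective only on [0, pi], so the other half of the period is reflected into it. *)
have : 2 * pi - y = 0.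
  apply: cos_eq1; first by lra.
  by rewrite mulr_natl addrC cosD2pi cosN.
by move=> /eqP; rewrite subr_eq0 => /eqP y2'; move: y2; rewrite -y2' ltxx.
Qed.

Lemma cvg_real_complex (u : nat -> R) (l : R) :
  u @ \oo --> l -> (fun n => (u n)%:C : C) @ \oo --> (l%:C : C).
Proof.
move=> ul; apply/cvgrPdist_lt => -[e e']; rewrite ltcE/= => /andP[/eqP-> e0].
have /cvgrPdist_lt/(_ e e0) := ul.
apply: filterS => n; rewrite -rmorphB normc_def/= expr0n addr0 sqrtr_sqr.
by move=> lun; rewrite ltcE/= eqxx.
Qed.

Lemma cvg_cis x :
  series (fun k => (k`!%:R)^-1 * ('i * x%:C : C) ^+ k) @ \oo --> cis x.
Proof.
rewrite (_ : series _ = fun n => (series (cos_coeff x) n)%:C +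
    'i * (series (sin_coeff x) n)%:C :> C); last first.
  apply/funext => n; rewrite /series/= !rmorph_sum mulr_sumr -big_split/=.
  apply: eq_bigr => k _.
  rewrite /= !(rmorphM (real_complex R)) !(rmorphXn (real_complex R)).
  rewrite !(fmorphV (real_complex R)) !(rmorph_nat (real_complex R)) (rmorphN1 (real_complex R)).
  rewrite exprMn mulrCA [RHS]addrC.
  (* Even powers of i give the cosine coefficients and odd ones the sine coefficients. *)
  have -> : ('i : C) ^+ k = (~~ odd k)%:R * (-1) ^+ k./2 + 'i * ((odd k)%:R * (-1)^+ k.-1./2).
    rewrite -{1}(odd_double_half k) exprD -mul2n exprM sqrCi.
    have half_pred : odd k -> k.-1./2 = k./2.
      by case: {+}k => //= k' /negPf ok'; rewrite uphalf_half ok'.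
    by case: (odd k) half_pred => [->|_]//; rewrite ?(mul0r, mul1r, mulr0, addr0, add0r).
  by ring.
have -> : cis x = (cos x)%:C + 'i * (sin x)%:C.
  by rewrite /cis [LHS]complexE.
apply: cvgD; last apply: cvgMl_tmp; apply: cvg_real_complex; rewrite unlock.
- exact: is_cvg_series_cos_coeff.
- exact: is_cvg_series_sin_coeff.
Qed.
End Cis.

(** * Exponentials of diagonalizable matrices *)

Section DiagonalExponential.
Variable R : realType.
Local Notation C := (complexField R).

Lemma conj_diag_exp n (P : 'M[C]_n) (d : 'rV[C]_n) k : P \in unitmx ->
  (invmx P *m diag_mx d *m P) ^+ k =
  invmx P *m diag_mx (\row_j d 0 j ^+ k) *m P.
Proof.
move=> uP.
have conjM (A B : 'M[C]_n) :
    (invmx P *m A *m P) *m (invmx P *m B *m P) = invmx P *m (A *m B) *m P.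
  by rewrite -!mulmxA (mulKVmx uP).
elim: k => [|k IH].
  rewrite (_ : \row_j _ = const_mx 1) ?diag_const_mx ?mulmx1 ?mulVmx//.
  by apply/rowP => j; rewrite !mxE expr0.
have -> (A : 'M[C]_n) : A ^+ k.+1 = A ^+ k *m A by exact: exprSr.
rewrite IH [LHS]conjM mulmx_diag.
apply: (congr1 (fun r => invmx P *m diag_mx r *m P)).
by apply/rowP => j; rewrite !mxE exprSr.
Qed.

(** Each entry of the partial sums is a fixed linear combination of scalar exponential series, whose
    limits are known from [cvg_cis]. *)
Lemma expmx_conj_diag n (P : 'M[C]_n) (x : 'I_n -> R) : P \in unitmx ->
  expmx (invmx P *m diag_mx (\row_j ('i * (x j)%:C : C)) *m P) =
  invmx P *m diag_mx (\row_j cis (x j)) *m P.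
Proof.
move=> uP; apply: limn_mx; apply: cvg_mx => i j.
have E (d : 'rV[C]_n) : (invmx P *m diag_mx d *m P) i j =
    \sum_l invmx P i l * d 0 l * P l j.
  by rewrite mxE; apply: eq_bigr => l _; rewrite mul_mx_diag mxE.
have ZE (a : C) (A : 'M[C]_n) : (a *: A) i j = a * A i j by rewrite mxE.
pose s l := series (fun k => (k`!%:R)^-1 * ('i * (x l)%:C : C) ^+ k).
rewrite E (_ : (fun m => _) = fun m => \sum_l invmx P i l * s l m * P l j).
  apply: cvg_sum_fin => l; rewrite mxE.
  by apply: cvgMr_tmp; apply: cvgMl_tmp; apply: cvg_cis.
apply/funext => m; rewrite /s /series/= summxE.
transitivity (\sum_(0 <= k < m) \sum_l (k`!%:R)^-1 *
    (invmx P i l * ('i * (x l)%:C : C) ^+ k * P l j)).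
  apply: eq_bigr => k _; rewrite -mulr_sumr conj_diag_exp//.
  apply: etrans (ZE _ _) _; congr (_ * _); rewrite E.
  by apply: eq_bigr => l _; rewrite !mxE.
rewrite exchange_big/=; apply: eq_bigr => l _.
rewrite mulr_sumr mulr_suml; apply: eq_bigr => k _.
by ring.
Qed.

End DiagonalExponential.

(** * Walks on functions and their spectral decomposition *)

Section Walk.
Variables (R : realType) (V : finType).
Local Notation C := (complexField R).
Implicit Types (G : sgraph V) (f g : V -> C) (u v x y : V) (t : R).

Definition colf f : 'cV[C]_#|V| := \col_i f (enum_val i).

(** The transition matrix acting on functions on V, so that the enumeration of vertices stays
    hidden. *)
Definition walk G t f x : C := (transition G t *m colf f) (enum_rank x) 0.

(** The zero function is allowed, which makes decompositions into eigenfunctions free of case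
    distinctions. *)
Definition eigenf G (theta : R) f :=
  forall x, \sum_y (adj G x y)%:R * f y = theta%:C * f x.

Definition ind u : V -> C := fun x => (x == u)%:R.

Lemma colfE f x : colf f (enum_rank x) 0 = f x.
Proof. by rewrite mxE enum_rankK. Qed.

Lemma basis_vecE u : basis_vec R u = colf (ind u).
Proof.
apply/colP => i; rewrite !mxE andbT /ind; congr (_%:R).
by rewrite (can2_eq (@enum_valK _) (@enum_rankK _)).
Qed.

Lemma adjmx_colf G f :
  adjmx R G *m colf f = colf (fun x => \sum_y (adj G x y)%:R * f y).
Proof.
apply/colP => i; rewrite !mxE (reindex _ (onW_bij _ (enum_val_bij V)))/=.
by apply: eq_bigr => j _; rewrite !mxE.
Qed.

Lemma eigenfP G theta f :
  eigenf G theta f <-> adjmx R G *m colf f = (theta%:C : C) *: colf f.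
Proof.
rewrite adjmx_colf; split=> [Gf|/colP Gf x].
  by apply/colP => i; rewrite !mxE Gf.
by have := Gf (enum_rank x); rewrite !mxE enum_rankK.
Qed.

Lemma adjmx_spectral G : exists (P : 'M[C]_#|V|) (lam : 'I_#|V| -> R),
  P \in unitmx /\ adjmx R G = invmx P *m diag_mx (\row_j (lam j)%:C) *m P.
Proof.
have herm : adjmx R G \is hermsymmx.
  apply/is_hermitianmxP; rewrite expr0 scale1r; apply/matrixP => i j.
  by rewrite !mxE adj_sym conjC_nat.
have /mxOverP real := hermitian_spectral_diag_real herm.
have /orthomx_spectralP AE := hermitian_normalmx herm.
exists (spectralmx (adjmx R G)), (fun j => complex.Re (spectral_diag (adjmx R G) 0 j)).
split; first exact: spectral_unit.
rewrite {1}AE.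
apply: (congr1 (fun r => invmx (spectralmx (adjmx R G)) *m diag_mx r *m spectralmx (adjmx R G))).
apply/rowP => j; rewrite mxE.
by rewrite RRe_real.
Qed.

Lemma transition_spectral G (P : 'M[C]_#|V|) (lam : 'I_#|V| -> R) t :
  P \in unitmx -> adjmx R G = invmx P *m diag_mx (\row_j (lam j)%:C) *m P ->
  transition G t = invmx P *m diag_mx (\row_j cis (- (t * lam j))) *m P.
Proof.
move=> uP AE; have <- := expmx_conj_diag (fun j => - (t * lam j)) uP.
rewrite /transition AE.
apply: (congr1 (@expmx C _)).
rewrite scalemxAl scalemxAr.
rewrite -linearZ/=.
apply: (congr1 (fun r => invmx P *m diag_mx r *m P)).
apply/rowP => j; rewrite !mxE.
rewrite (rmorphN (real_complex R)) (rmorphM (real_complex R)) mulrN mulNr mulrA.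
by [].
Qed.

(** In spectral coordinates, every nonzero coordinate of f belongs to an eigenvalue [lam j] equal to
    theta, so all of them receive the same phase. *)
Lemma walk_eigenf G theta f t x : eigenf G theta f ->
  walk G t f x = cis (- (t * theta)) * f x.
Proof.
have [P [lam [uP AE]]] := adjmx_spectral G.
move=> /eigenfP; rewrite AE => Gf.
have Pf j : (lam j)%:C * (P *m colf f) j 0 = theta%:C * (P *m colf f) j 0.
  have := congr1 (mulmx P) Gf; rewrite -!mulmxA mulKVmx// -scalemxAr.
  by move=> /colP/(_ j); rewrite mul_diag_mx !mxE.
suff -> : walk G t f = fun x => cis (- (t * theta)) * f x by [].
apply/funext => {}x; rewrite /walk (transition_spectral t uP AE) -!mulmxA.
rewrite (_ : diag_mx _ *m _ = cis (- (t * theta)) *: (P *m colf f)).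
  by rewrite -scalemxAr mulKmx// mxE colfE.
apply/colP => j; rewrite mul_diag_mx !mxE -[\sum_k _ * _]/(_).
have := Pf j; rewrite !mxE; set w := \sum_k _.
have [->|w0] := eqVneq w 0; first by rewrite !mulr0.
by move=> /(mulIf w0) [->].
Qed.

Lemma walk_sum G t (I : finType) (g : I -> V -> C) x :
  walk G t (fun y => \sum_i g i y) x = \sum_i walk G t (g i) x.
Proof.
rewrite /walk (_ : colf _ = \sum_i colf (g i)).
  by rewrite mulmx_sumr summxE.
by apply/colP => k; rewrite summxE mxE; apply: eq_bigr => i _; rewrite mxE.
Qed.

Lemma walkZ G t a f x : walk G t (fun y => a * f y) x = a * walk G t f x.
Proof.
rewrite /walk (_ : colf _ = a *: colf f) -?scalemxAr ?mxE//.
by apply/colP => k; rewrite !mxE.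
Qed.

(** The columns of P^-1 are eigenvectors, weighted here by the coordinates of f. Identities between
    walks can then be checked on eigenfunctions. *)
Lemma eigenf_span G f : exists (lam : 'I_#|V| -> R) (g : 'I_#|V| -> V -> C),
  (forall j, eigenf G (lam j) (g j)) /\ f = fun x => \sum_j g j x.
Proof.
have [P [lam [uP AE]]] := adjmx_spectral G.
exists lam, (fun j x => invmx P (enum_rank x) j * (P *m colf f) j 0); split.
  move=> j; apply/eigenfP; set c := (P *m colf f) j 0.
  have -> : colf (fun x => invmx P (enum_rank x) j * c) = c *: col j (invmx P).
    by apply/colP => i; rewrite !mxE enum_valK mulrC.
  rewrite AE -scalemxAr scalerA [_ * c]mulrC -scalerA; congr (_ *: _).
  rewrite colE -!mulmxA (mulKVmx uP) scalemxAr; congr (_ *m _).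
  apply/colP => i; rewrite mul_diag_mx !mxE.
  by have [->|] := eqVneq i j; rewrite ?mulr0.
apply/funext => x; rewrite -[LHS]colfE -(mulKmx uP (colf f)) mxE.
by apply: eq_bigr => j _; rewrite mulKmx.
Qed.
End Walk.

Section WalkTheory.
Variables (R : realType) (V : finType) (G : sgraph V).
Local Notation C := (complexField R).
Implicit Types (f g : V -> C) (u v : V) (s t : R).

Lemma walk_add s t f : walk G s (walk G t f) = walk G (s + t) f.
Proof.
have [lam [g [gE ->]]] := eigenf_span G f.
have walkE r : walk G r (fun x => \sum_j g j x) =
    fun x => \sum_j cis (- (r * lam j)) * g j x.
  apply/funext => x; rewrite walk_sum; apply: eq_bigr => j _; exact: walk_eigenf.
rewrite !walkE; apply/funext => x; rewrite walk_sum; apply: eq_bigr => j _.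
by rewrite walkZ (walk_eigenf _ _ (gE j)) mulrA -cisD mulrDl opprD addrC.
Qed.

Lemma walk0 f : walk G 0 f = f.
Proof.
have [lam [g [gE ->]]] := eigenf_span G f.
apply/funext => x; rewrite walk_sum; apply: eq_bigr => j _.
by rewrite (walk_eigenf _ _ (gE j)) mul0r oppr0 cis0 mul1r.
Qed.

Lemma walk_eigenvector_exp f (gamma : C) t (n : int) : gamma != 0 ->
  walk G t f = (fun x => gamma * f x) ->
  walk G (t * n%:~R) f = fun x => gamma ^ n * f x.
Proof.
move=> gamma0 Gf.
have pos (m : nat) : walk G (t * m%:R) f = fun x => gamma ^+ m * f x.
  elim: m => [|m IH]; first by rewrite mulr0 walk0; apply/funext => x; rewrite mul1r.
  rewrite -natr1 mulrDr mulr1 -walk_add Gf; apply/funext => x.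
  by rewrite walkZ IH exprS mulrA.
case: n => n; first by rewrite -pmulrn pos.
rewrite NegzE mulrNz mulrN -pmulrn -exprnN.
(* For negative exponents, the walk over the positive time is undone and gamma^(n+1) is divided
   out. *)
have := walk_add (- (t * n.+1%:R)) (t * n.+1%:R) f; rewrite addNr walk0 pos.
move=> e; apply/funext => x; have := congr1 (@^~ x) e.
by rewrite walkZ => <-; rewrite mulKf// expf_neq0.
Qed.

Lemma pgst_walk u v (t : nat -> R) (gamma : C) : u != v -> `|gamma| = 1 ->
  (forall x, (fun m => walk G (t m) (ind R u) x) @ \oo --> gamma * ind R v x) ->
  pgst R G.
Proof.
move=> uv gamma1 Gt; exists u, v; split; first exact/eqP.
exists t, gamma; split=> //; apply: cvg_mx => i j; rewrite (ord1 j).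
rewrite (_ : (fun m => _) = (fun m => walk G (t m) (ind R u) (enum_val i))); last first.
  by apply/funext => m; rewrite /walk enum_valK basis_vecE.
by rewrite basis_vecE !mxE; exact: Gt.
Qed.

Lemma periodic_walk u t : periodic_at G u t -> exists gamma : C, `|gamma| = 1 /\
  walk G t (ind R u) = fun x => gamma * ind R u x.
Proof.
move=> [gamma [gamma1 Gu]]; exists gamma; split=> //; apply/funext => x.
by rewrite /walk -basis_vecE Gu mxE basis_vecE colfE.
Qed.

Lemma adj_sum_degree x :
  \sum_y (adj G x y)%:R = (#|[set y | adj G x y]%SET|)%:R :> C.
Proof.
by rewrite -natr_sum cardsE -sum1_card [in RHS]big_mkcond/=; congr (_%:R).
Qed.

(** Row sums of the adjacency matrix are degrees. In this spectral form, closure of regularity under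
    products and complements is an eigenvalue computation. *)
Lemma regular_eigenf : regular G <-> exists mu : R, eigenf G mu (fun=> 1).
Proof.
split=> [[d Gd]|[mu Gmu]].
  by exists d%:R => x; rewrite -mulr_suml adj_sum_degree Gd (rmorph_nat (real_complex R)).
have deg x : (#|[set y | adj G x y]%SET|)%:R = mu%:C :> C.
  by rewrite -adj_sum_degree -[RHS]mulr1 -(Gmu x); under [RHS]eq_bigr do rewrite mulr1.
(* A vertex supplies the common degree; without vertices any number serves. *)
have [[x _]|V0] := pselect (exists x : V, True).
  exists #|[set y | adj G x y]%SET| => y; apply/eqP.
  by rewrite -(eqr_nat C) !deg.
by exists 0%N => x; case: V0; exists x.
Qed.

End WalkTheory.

(** * Cartesian products *)

Section CartesianProduct.
Variables (R : realType) (V W : finType) (G : sgraph V) (K : sgraph W).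
Local Notation C := (complexField R).
Implicit Types (f : V -> C) (g : W -> C).

(** The adjacency matrix is A(G) x I + I x A(K) in tensor notation: the two kinds of edges exclude
    each other because there are no loops. *)
Lemma eigenf_cart theta mu f g : eigenf G theta f -> eigenf K mu g ->
  eigenf (cart_graph G K) (theta + mu) (fun p => f p.1 * g p.2).
Proof.
move=> Gf Kg [x y].
have cartE p : ((adj (cart_graph G K) (x, y) p)%:R : C) =
    (adj G x p.1)%:R * (p.2 == y)%:R + (p.1 == x)%:R * (adj K y p.2)%:R.
  rewrite /= /cart_adj/= [y == _]eq_sym [x == _]eq_sym.
  have [->|_] := eqVneq p.1 x; have [->|_] := eqVneq p.2 y;
    by rewrite ?adj_irr ?andbF ?andbT ?orbF ?(mulr0, mulr1, mul0r, mul1r, addr0, add0r).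
under eq_bigr do rewrite cartE mulrDl.
rewrite big_split/= rmorphD/= mulrDl; congr (_ + _).
  rewrite mulrA -Gf mulr_suml.
  rewrite -(pair_bigA _ (fun p q => (adj G x p)%:R * (q == y)%:R * (f p * g q)))/=.
  apply: eq_bigr => p _; rewrite (bigD1 y)//= eqxx mulr1 mulrA big1 ?addr0// => q /negPf->.
  by rewrite mulr0 mul0r.
rewrite mulrCA -Kg mulr_sumr.
rewrite -(pair_bigA _ (fun p q => (p == x)%:R * (adj K y q)%:R * (f p * g q)))/=.
rewrite exchange_big/=.
apply: eq_bigr => q _; rewrite (bigD1 x)//= eqxx mul1r mulrCA big1 ?addr0// => p /negPf->.
by rewrite !mul0r.
Qed.

(** Eigenvalues add on products of eigenfunctions, so phases multiply; the general case follows by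
    decomposing both factors. *)
Lemma walk_cart t f g p : walk (cart_graph G K) t (fun p => f p.1 * g p.2) p =
  walk G t f p.1 * walk K t g p.2.
Proof.
have [lam [f_ [Gf ->]]] := eigenf_span G f.
have [mu [g_ [Kg ->]]] := eigenf_span K g.
rewrite (_ : (fun p => _) = fun p => \sum_i \sum_j f_ i p.1 * g_ j p.2); last first.
  apply/funext => q; rewrite mulr_suml; apply: eq_bigr => i _; exact: mulr_sumr.
rewrite !walk_sum mulr_suml; apply: eq_bigr => i _.
rewrite walk_sum mulr_sumr; apply: eq_bigr => j _.
rewrite (walk_eigenf _ _ (eigenf_cart (Gf i) (Kg j))) (walk_eigenf _ _ (Gf i)).
by rewrite (walk_eigenf _ _ (Kg j)) mulrDr opprD cisD mulrACA.
Qed.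

Lemma regular_cart : regular G -> regular K -> regular (cart_graph G K).
Proof.
move=> /(regular_eigenf R)[mu Gmu] /(regular_eigenf R)[nu Knu].
apply/(regular_eigenf R); exists (mu + nu).
rewrite (_ : (fun=> 1) = fun p => 1 * 1 :> C); last by apply/funext => p; rewrite mulr1.
exact: eigenf_cart Gmu Knu.
Qed.
End CartesianProduct.

(** * Complements of regular graphs *)

Section Complement.
Variables (R : realType) (V : finType) (G : sgraph V) (d : nat).
Local Notation C := (complexField R).
Hypothesis Gd : forall x, #|[set y | adj G x y]%SET| = d.

Lemma degree_sum x : \sum_y (adj G x y)%:R = d%:R :> C.
Proof. by rewrite adj_sum_degree Gd. Qed.

Lemma adj_sum_swap (f : V -> C) :
  \sum_x \sum_y (adj G x y)%:R * f y = d%:R * \sum_y f y.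
Proof.
rewrite exchange_big mulr_sumr/=; apply: eq_bigr => y _.
rewrite -mulr_suml; congr (_ * _); rewrite -(degree_sum y).
by apply: eq_bigr => x _; rewrite adj_sym.
Qed.

(** This is the identity J - I - A for the adjacency matrix of the complement. *)
Lemma compl_sum (f : V -> C) x : \sum_y (adj (compl_graph G) x y)%:R * f y =
  \sum_y f y - f x - \sum_y (adj G x y)%:R * f y.
Proof.
have e y : ((adj (compl_graph G) x y)%:R : C) = 1 - (y == x)%:R - (adj G x y)%:R.
  rewrite /= eq_sym; have [->|_] := eqVneq y x.
    by rewrite adj_irr subrr subr0.
  by case: (adj G x y); rewrite ?subr0 ?subrr.
under eq_bigr do rewrite e !mulrBl mul1r.
rewrite !sumrB; congr (_ - _ - _).
by rewrite (bigD1 x)//= eqxx mul1r big1 ?addr0// => y /negPf->; rewrite mul0r.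
Qed.

Lemma compl_eigenf_cst c :
  eigenf (compl_graph G) (#|V|%:Z - 1 - d%:Z)%:~R (fun=> c : C).
Proof.
move=> y; rewrite compl_sum -mulr_suml degree_sum sumr_const -[c *+ _]mulr_natr.
by rewrite (rmorph_int (real_complex R)) !intrB -!pmulrn; ring.
Qed.

Lemma regular_compl : regular (compl_graph G).
Proof. by apply/(regular_eigenf R); eexists; exact: compl_eigenf_cst. Qed.

(* The constant and mean-zero parts of an eigenfunction of G are eigenfunctions
   of its complement; c (theta - d) = 0, where c is the mean value. *)
Lemma walk_compl (f : V -> C) (n : int) :
  walk (compl_graph G) (2 * pi * n%:~R) f = walk G (- (2 * pi * n%:~R)) f.
Proof.
set T := 2 * pi * n%:~R.
have cisT (m : int) : cis (T * m%:~R) = 1.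
  by rewrite /T -mulrA -intrM cis_2pi_int.
have [lam [g [Gg ->]]] := eigenf_span G f.
apply/funext => x; rewrite !walk_sum; apply: eq_bigr => j _.
rewrite (walk_eigenf _ _ (Gg j)) mulNr opprK.
move: (lam j) (g j) (Gg j) => theta h Gh {lam g Gg j f}.
have V0 : #|V|%:R != 0 :> C by rewrite pnatr_eq0 -lt0n; apply/card_gt0P; exists x.
pose c := (\sum_y h y) / #|V|%:R; pose h' y := h y - c.
have cd : c * (theta%:C - d%:R) = 0.
  rewrite /c mulrAC mulrBr; have := adj_sum_swap h.
  under eq_bigr do rewrite Gh.
  by rewrite -mulr_sumr ![_ * \sum_y _]mulrC => ->; rewrite subrr mul0r.
have h'E : eigenf (compl_graph G) (- (1 + theta)) h'.
  move=> y; rewrite compl_sum sumrB sumr_const -[c *+ _]mulr_natr divfK// subrr.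
  under eq_bigr do rewrite mulrBr.
  rewrite sumrB Gh -mulr_suml degree_sum /h' rmorphN rmorphD rmorph1.
  have : c * theta%:C - c * d%:R = 0 by rewrite -mulrBr.
  move/eqP; rewrite subr_eq0 => /eqP e; rewrite [d%:R * _]mulrC -e; ring.
have cE := compl_eigenf_cst c.
(* The two-term decomposition is written as a sum over booleans to make [walk_sum] applicable. *)
have -> : h = fun y => \sum_(b : bool) (if b then c else h' y).
  by apply/funext => y; rewrite big_bool/= /h' addrC subrK.
rewrite walk_sum !big_bool/=.
rewrite (walk_eigenf _ _ cE) (walk_eigenf _ _ h'E).
have -> : cis (- (T * - (1 + theta))) = cis (T * theta).
  by rewrite mulrN opprK mulrDr cisD (cisT 1%:Z) mul1r.
rewrite -mulrN -intrN cisT mul1r [RHS]mulrDr; congr (_ + _).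
have [->|c0] := eqVneq c 0; first by rewrite mulr0.
move: cd => /eqP; rewrite mulf_eq0 (negPf c0) /= subr_eq0 => /eqP e.
have -> : theta = d%:R by apply: (@complexI R); rewrite e (rmorph_nat (real_complex R)).
by rewrite (cisT d%:Z) mul1r.
Qed.

End Complement.

(** * Cycles with gcd graphs *)

Section Characters.
Variables (F : fieldType) (n : nat) (z : F).
Hypotheses (n1 : (1 < n)%N) (zn : z ^+ n = 1).
Implicit Types a b : 'Z_n.

Lemma val_ZpD a b : (a + b)%R = ((a + b) %% n)%N :> nat.
Proof. by rewrite /=; congr (_ %% _)%N; exact: Zp_cast. Qed.

Lemma chiD a b : z ^+ (a + b)%R = z ^+ a * z ^+ b.
Proof. by rewrite val_ZpD (expr_mod _ zn) exprD. Qed.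

Lemma chi_neq0 : z != 0.
Proof.
by apply: contra_eq_neq zn => ->; rewrite expr0n eqn0Ngt (ltnW n1) eq_sym oner_eq0.
Qed.

Lemma chiN a : z ^+ (- a)%R = (z ^+ a)^-1.
Proof.
apply: (mulIf (expf_neq0 a chi_neq0)); rewrite -chiD addNr mulVf//.
exact/expf_neq0/chi_neq0.
Qed.

Lemma chi_nat (m : nat) : z ^+ (m%:R : 'Z_n) = z ^+ m.
Proof. by rewrite val_Zp_nat// (expr_mod _ zn). Qed.

(** If z^d = 1 all terms are 1. Otherwise translation by d permutes the multiples of d and
    multiplies the sum by z^d, so the sum is 0. *)
Lemma chi_sum_multiples (d : nat) : (d %| n)%N ->
  exists m : int, \sum_(a : 'Z_n | (d %| a)%N) z ^+ a = m%:~R.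
Proof.
move=> dn; have [zd|zd] := eqVneq (z ^+ d) 1.
  exists #|[pred a : 'Z_n | (d %| a)%N]|%:Z.
  rewrite (eq_bigr (fun=> 1)) ?sumr_const// => a /dvdnP[q ->].
  by rewrite mulnC exprM zd expr1n.
exists 0; set T := \sum_(a | _) _.
have : z ^+ d * T = T.
  rewrite mulr_sumr [RHS](reindex_inj (addrI (d%:R : 'Z_n))).
  apply: eq_big => [a|a _]; last by rewrite chiD chi_nat.
  by rewrite val_ZpD val_Zp_nat// /dvdn modn_dvdm// -modnDml modn_dvdm// modnn.
move/eqP; rewrite -subr_eq0 -[X in _ - X]mul1r -mulrBl mulf_eq0 subr_eq0.
by rewrite (negPf zd) => /eqP.
Qed.

(* The multiples of 2^i minus those of 2^(i+1). *)
Lemma chi_sum_gcd_class (k i : nat) : n = (2 ^ k)%N -> (i < k)%N ->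
  exists m : int, \sum_(a : 'Z_n | gcdn a n == (2 ^ i)%N) z ^+ a = m%:~R.
Proof.
move=> nk ik.
have [|p pE] := @chi_sum_multiples (2 ^ i); first by rewrite nk dvdn_exp2l// ltnW.
have [|q qE] := @chi_sum_multiples (2 ^ i.+1); first by rewrite nk dvdn_exp2l.
exists (p - q); rewrite intrB -pE -qE; apply/eqP; rewrite eq_sym subr_eq; apply/eqP.
rewrite (bigID (fun a : 'Z_n => (2 ^ i.+1 %| a)%N))/= addrC; congr (_ + _).
  apply: eq_bigl => a; move: (nat_of_ord a) => {}a; rewrite nk.
  apply/andP/eqP => [[ia iNa]|e].
    have /(dvdn_pfactor _ _ (isT : prime 2))[j jk e] := dvdn_gcdr a (2 ^ k).
    rewrite e; congr (2 ^ _)%N; apply/eqP; rewrite eqn_leq; apply/andP; split.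
      rewrite leqNgt; apply: contra iNa => ij.
      by rewrite (dvdn_trans (dvdn_exp2l 2 ij))// -e dvdn_gcdl.
    by rewrite -(@dvdn_Pexp2l 2)// -e dvdn_gcd ia dvdn_exp2l// ltnW.
  split; first by rewrite -e dvdn_gcdl.
  apply/negP => ia; have : (2 ^ i.+1 %| 2 ^ i)%N by rewrite -e dvdn_gcd ia dvdn_exp2l.
  by rewrite dvdn_Pexp2l// ltnn.
apply: eq_bigl => a; apply/andP/idP => [[]//|ia]; split=> //.
by apply: dvdn_trans ia; rewrite dvdn_exp2l.
Qed.

(** The proper divisors of 2^k are the 2^i with i < k, and their gcd classes are disjoint, so the
    integer sums over the classes add up. *)
Lemma chi_sum_gcd_set (k : nat) (D : {set 'I_n}) : n = (2 ^ k)%N ->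
  D \subset proper_divisors n ->
  exists m : int, \sum_(a in gcd_set D) z ^+ a = m%:~R.
Proof.
move=> nk /fintype.subsetP Ddiv.
have E d : exists m : int, d \in D -> \sum_(a in gcd_class n d) z ^+ a = m%:~R.
  have [dD|_] := boolP (d \in D); last by exists 0.
  have := Ddiv d dD; rewrite inE => dn.
  have [i di] : exists i, d = (2 ^ i)%N :> nat.
    have : (d %| 2 ^ k)%N by rewrite -nk.
    by case/(dvdn_pfactor d k (isT : prime 2)) => i _ ->; exists i.
  have [|m mE] := @chi_sum_gcd_class k i nk.
    by rewrite -(@ltn_exp2l 2)// -di -nk ltn_ord.
  exists m => _; rewrite -mE; apply: eq_bigl => a; by rewrite inE di.
have [m mE] := choice E.
exists (\sum_(d in D) m d); rewrite rmorph_sum/= /gcd_set.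
have -> : (\bigcup_(d in D) gcd_class n d)%SET =
    (\bigcup_d (if d \in D then gcd_class n d else finset.set0))%SET.
  exact: big_mkcond.
rewrite partition_disjoint_bigcup => [|i j ij].
  rewrite [RHS]big_mkcond; apply: eq_bigr => d _.
  by case: ifP => [/mE//|_]; rewrite big_set0.
rewrite -setI_eq0; apply/eqP/setP => a; rewrite !inE.
case: ifP => _; rewrite ?inE//; case: ifP => _; rewrite ?inE ?andbF//.
apply: contraNF ij => /andP[/eqP ei /eqP ej].
by apply/eqP/val_inj; rewrite /= -ei -ej.
Qed.

End Characters.

Section CycleGcd.
Variable R : realType.
Local Notation C := (complexField R).

Lemma cis_addV (x : R) : cis x + (cis x)^-1 = (2 * cos x)%:C.
Proof.
rewrite -cisN /cis cosN sinN; apply/eqP; rewrite eq_complex/= subrr eqxx andbT.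
by apply/eqP; ring.
Qed.

Lemma one_neqN1_Zp (n : nat) : (2 < n)%N -> (1 : 'Z_n) != -1.
Proof.
move=> n2; rewrite -addr_eq0 -[1 + 1]/(2%:R); apply/eqP => /(congr1 (@nat_of_ord _)).
by rewrite val_Zp_nat ?(ltnW n2)// modn_small.
Qed.

Lemma one_notin_gcd_set (n : nat) (D : {set 'I_n}) : (1 < n)%N ->
  (forall d, d \in D -> d <> 1%N :> nat) -> (1 : 'Z_n) \notin gcd_set D.
Proof.
move=> n1 D1; apply/finset.bigcupP => -[d /D1 d1]; rewrite inE.
have -> : (1 : 'Z_n) = 1%N :> nat by have := val_Zp_nat n1 1; rewrite modn_small.
by rewrite gcd1n => /eqP/esym.
Qed.

(** The eigenvalue is the sum of z^-s over the connection set: s = 1 and s = -1 give 2 cos x, the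
    gcd set gives an integer. As 1 is not in D, neither of these s lies in the gcd set, so nothing
    is counted twice. *)
Lemma Gfam_eigenf k (G : sgraph 'Z_(2 ^ k)) (x : R) : (3 <= k)%N -> Gfam G ->
  cis x ^+ (2 ^ k) = 1 ->
  exists m : int, eigenf G (2 * cos x + m%:~R) (fun a => cis x ^+ a).
Proof.
move=> k3 [D [Ddiv D1 ->]]; set n := (2 ^ k)%N; set z := cis x => zn.
have n2 : (2 < n)%N by rewrite (@ltn_exp2l 2 1)// (leq_trans _ k3).
have n1 := ltnW n2.
have wn : z^-1 ^+ n = 1 by rewrite exprVn zn invr1.
have [m mE] := @chi_sum_gcd_set _ n z^-1 n1 wn k D erefl Ddiv.
have S1 := one_notin_gcd_set n1 D1.
have SN1 : (-1 : 'Z_n) \notin gcd_set D.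
  apply: contra S1 => /finset.bigcupP[d dD d1]; apply/finset.bigcupP; exists d => //.
  by rewrite -[1]opprK gcd_classN.
have N11 := one_neqN1_Zp n2.
exists m => a; rewrite (reindex_inj (subrI a))/=.
have adjE (s : 'Z_n) :
    ((cycle_adj a (a - s) || gcd_adj D a (a - s))%:R : C) =
    (s == 1)%:R + (s == -1)%:R + (s \in gcd_set D)%:R.
  rewrite /cycle_adj /gcd_adj subKr.
  have [->|s1] := eqVneq s 1; first by rewrite (negPf N11) (negPf S1) !addr0.
  have [->|sN1] := eqVneq s (-1); first by rewrite (negPf SN1) add0r addr0.
  by rewrite !add0r.
have chiE (s : 'Z_n) : z ^+ (a - s)%R = z ^+ a * z^-1 ^+ s.
  by rewrite chiD// chiN// exprVn.
have single (b : 'Z_n) : \sum_(s : 'Z_n) (s == b)%:R * z^-1 ^+ s = z^-1 ^+ b.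
  by rewrite (bigD1 b)//= eqxx mul1r big1 ?addr0// => s /negPf->; rewrite mul0r.
under eq_bigr do rewrite adjE chiE mulrCA !mulrDl.
rewrite -mulr_sumr !big_split/= !single mulrC; congr (_ * _).
have -> : (2 * cos x + m%:~R)%:C = z + z^-1 + m%:~R :> C.
  by rewrite cis_addV -(rmorph_int (real_complex R)) -(rmorphD (real_complex R)).
rewrite -mE; congr (_ + _); last first.
  by rewrite [RHS]big_mkcond; apply: eq_bigr => s _; case: ifP; rewrite ?mul1r ?mul0r.
by rewrite chiN// invrK addrC; congr (_ + _); have := @chi_nat _ n z^-1 n1 wn 1.
Qed.



Lemma dist_inv (u v : C) : `|u| = 1 -> `|v| = 1 -> `|u^-1 - v^-1| = `|u - v|.
Proof.
move=> u1 v1; have u0 : u != 0 by rewrite -normr_gt0 u1.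
have v0 : v != 0 by rewrite -normr_gt0 v1.
have -> : u^-1 - v^-1 = (v - u) / (u * v) by field; rewrite u0 v0.
by rewrite normf_div normrM u1 v1 mulr1 divr1 distrC.
Qed.

(** With N = 2^c a quarter of the cycle length, Kronecker's theorem handles 0 < j < N, where the
    cosines are independent; the remaining j follow from the symmetries of the cosine. *)
Lemma cycle_approx (c : nat) (e : R) : (0 < c)%N -> 0 < e ->
  let alpha := 2 * pi / (2 ^ c.+2)%:R in
  exists m : nat, forall j, (j < 2 ^ c.+2)%N ->
    `|cis (2 * pi * (2 * cos (alpha * j%:R))) ^+ m - (-1) ^+ j| < e%:C.
Proof.
move=> c0 e0 alpha; set N := (2 ^ c)%N.
have n4N : (2 ^ c.+2 = 4 * N)%N by rewrite !expnS mulnA.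
have alphaE : alpha * (2 * N)%:R = pi.
  rewrite /alpha n4N !natrM; field.
  by rewrite pnatr_eq0 expn_eq0.
pose z := cis alpha.
have zE j : cis (alpha * j%:R) = z ^+ j by rewrite mulr_natr cisMn.
have zN : z ^+ (2 ^ c.+1) = -1 by rewrite expnS -zE alphaE cis_pi.
pose w j : C := cis (2 * pi * (2 * cos (alpha * j%:R))).
have oddN : ~~ odd N by rewrite oddX eqn0Ngt c0.
have [||||m mP] := @kronecker R 'I_N.-1 (fun i => w i.+1) (fun i => (-1) ^+ i.+1) _ _ _ e.
- by move=> i; rewrite norm_cis.
- by move=> i; rewrite normrX normrN1 expr1n.
- move=> l; under eq_bigr do rewrite /w -cisMz; rewrite -cis_sum.
  move=> /cis_eq1[l0]; under eq_bigr do rewrite -(mulrA (2 * pi)). rewrite -mulr_sumr.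
  have pi0 : 2 * pi != 0 :> R by rewrite mulf_neq0 ?pnatr_eq0// gt_eqF// pi_gt0.
  move=> /(mulfI pi0)/(congr1 (real_complex R)); rewrite (rmorph_int (real_complex R)).
  rewrite (rmorph_sum (real_complex R)) => lsum.
  apply: (two_cos_independent zN (l0 := l0)); rewrite -lsum; apply: eq_bigr => i _.
  by rewrite (rmorphM (real_complex R)) (rmorph_int (real_complex R)) -zE cis_addV mulrC.
- exact: e0.
exists m; rewrite -/(w _) n4N.
pose P j := `|w j ^+ m - (-1) ^+ j| < e%:C.
have e0' : 0 < e%:C :> C by rewrite ltcR.
(* At j = N the cosine is 0 and the target is 1 because N is even, which uses c > 0; at j = 0 the
   phase is exp(4 pi i) = 1. *)
have P1 j : (j <= N)%N -> P j.
  rewrite leq_eqVlt => /predU1P[->|jN]; rewrite /P /w.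
    have -> : alpha * N%:R = pi / 2 by rewrite -alphaE natrM; field.
    by rewrite cos_pihalf !mulr0 cis0 expr1n -signr_odd (negPf oddN) subrr normr0.
  case: j jN => [|j] jN.
    by rewrite mulr0 cos0 mulr1 -[X in _ * X]/(2%:~R) cis_2pi_int expr1n subrr normr0.
  have jN' : (j < N.-1)%N by lia.
  exact: (mP (Ordinal jN')).
(* Replacing j by 2N - j negates the cosine, hence inverts the phase, while the target is its own
   inverse. *)
have P2 j : (j <= 2 * N)%N -> P j.
  move=> j2N; have [/P1//|Nj] := leqP j N.
  have /P1 : (2 * N - j <= N)%N by lia.
  rewrite /P /w natrB// mulrBr alphaE [pi - _]addrC cosDpi cosN !mulrN cisN exprVn.
  have -> : (-1) ^+ (2 * N - j) = ((-1) ^+ j)^-1 :> C.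
    by rewrite invr_sign -signr_odd oddB// oddM addbC/= addbF signr_odd.
  by rewrite dist_inv// ?normrX ?norm_cis ?normrN1 expr1n.
(* Replacing j by 4N - j changes neither the cosine nor the parity. *)
move=> j j4N; have [/P2//|Nj] := leqP j (2 * N).
have /P2 : (4 * N - j <= 2 * N)%N by lia.
rewrite /P /w natrB ?(ltnW j4N)// mulrBr.
have -> : alpha * (4 * N)%:R = pi *+ 2 by rewrite -alphaE !natrM mulr2n; ring.
rewrite [pi *+ 2 - _]addrC cosD2pi cosN.
by rewrite -[in X in X -> _]signr_odd oddB ?(ltnW j4N)// oddM addFb signr_odd.
Qed.

End CycleGcd.

(** * Transfer at integer times *)

Lemma increasing_seq_cvgny (phi : nat -> nat) : increasing_seq phi -> phi @ \oo --> \oo.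
Proof.
move=> incr; apply/cvgnyPge => A; exists A => // n /= An.
apply: leq_trans An _; elim: n => // n IH.
by apply: leq_ltn_trans IH _; rewrite ltnNge -leEnat incr -ltnNge.
Qed.

Section ComplexSequences.
Variable R : realType.
Local Notation C := (complexField R).

Lemma cvg_bound_inv (u : nat -> C) (l : C) :
  (forall s : nat, `|u s - l| < (s.+1%:R^-1)%:C) -> u @ \oo --> l.
Proof.
move=> ul; apply/cvgrPdist_lt => -[e e']; rewrite ltcE/= => /andP[/eqP-> e0].
have := near_infty_natSinv_lt (PosNum e0); apply: filterS => s /= se.
by rewrite distrC (lt_trans (ul s))// ltcR.
Qed.

(** Bolzano-Weierstrass is applied to the real parts, then to the imaginary parts along the first
    subsequence. *)
Lemma unit_circle_subsequence (u : nat -> C) : (forall s, `|u s| = 1) ->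
  exists (phi : nat -> nat) (gamma : C),
    [/\ phi @ \oo --> \oo, `|gamma| = 1 & (u \o phi) @ \oo --> gamma].
Proof.
move=> u1.
have bnd (f : nat -> R) : (forall s, `|f s| <= 1) -> bounded_fun f.
  move=> f1; exists 1; split; first exact: real1.
  by move=> x x1 s _; apply: le_trans (f1 s) (ltW x1).
have Re1 s : `|complex.Re (u s)| <= 1.
  by rewrite -lecR (le_trans (normc_ge_Re _))// u1.
have Im1 s : `|complex.Im (u s)| <= 1.
  have := normc_ge_Re (u s * 'i); rewrite ReiNIm normrN normrM u1 mul1r => H.
  by rewrite -lecR (le_trans H)// normc_def/= expr0n/= expr1n add0r sqrtr1.
have [phi phi_incr /cvg_ex[/= a ua]] := bolzano_weierstrass (bnd _ Re1).
have [psi psi_incr /cvg_ex[/= b ub]] := bolzano_weierstrass (bnd _ (fun s => Im1 (phi s))).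
have psiy := increasing_seq_cvgny psi_incr.
have phiy := increasing_seq_cvgny phi_incr.
pose gamma : C := a%:C + 'i * b%:C.
have ug : (u \o (phi \o psi)) @ \oo --> gamma.
  rewrite (_ : _ \o _ = fun s => (complex.Re (u (phi (psi s))))%:C +
      'i * (complex.Im (u (phi (psi s))))%:C :> C); last first.
    by apply/funext => s; rewrite /= [LHS]complexE.
  apply: cvgD; last apply: cvgMl_tmp; apply: cvg_real_complex => //.
  exact: (cvg_comp _ _ psiy ua).
exists (phi \o psi), gamma; split => //; first exact: (cvg_comp _ _ psiy phiy).
have ng : (fun s => `|(u \o (phi \o psi)) s|) @ \oo --> (`|gamma| : C).
  exact: (@cvg_norm _ C).
apply: (cvg_unique (@norm_hausdorff _ C^o) ng).
rewrite (_ : (fun s => _) = fun=> 1); first exact: cvg_cst.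
by apply/funext => s /=.
Qed.

End ComplexSequences.

Section IntegerTimes.
Variable R : realType.
Local Notation C := (complexField R).

(* Both signs are required because taking complements reverses time. *)
Definition integer_pgst (V : finType) (G : sgraph V) : Prop :=
  exists (u v : V) (m : nat -> int), u != v /\ forall x,
    (fun s => walk G (2 * pi * (m s)%:~R) (ind R u) x) @ \oo --> ind R v x /\
    (fun s => walk G (- (2 * pi * (m s)%:~R)) (ind R u) x) @ \oo --> ind R v x.

Lemma integer_pgst_compl (V : finType) (G : sgraph V) :
  regular G -> integer_pgst G -> integer_pgst (compl_graph G).
Proof.
move=> [d Gd] [u [v [m [uv Gm]]]]; exists u, v, m; split; first exact: uv.
move=> x; have [pos neg] := Gm x; split.
  under eq_fun do rewrite (walk_compl Gd).
  exact: neg.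
have compl_neg s : walk (compl_graph G) (- (2 * pi * (m s)%:~R)) (ind R u) =
    walk G (2 * pi * (m s)%:~R) (ind R u).
  by have := walk_compl Gd (ind R u) (- m s); rewrite intrN mulrN opprK.
under eq_fun do rewrite compl_neg.
exact: pos.
Qed.

(** The integer part m of the eigenvalue contributes only a multiple of 2 pi to the angle. *)
Lemma cis_integer_time (y : R) (M m : int) :
  cis (2 * pi * M%:~R * (y + m%:~R)) = cis (2 * pi * y) ^ M.
Proof.
by rewrite mulrDr cisD -[X in _ * cis X]mulrA -intrM cis_2pi_int mulr1 mulrAC cisMz.
Qed.

(** Fourier inversion for the point mass at 0: summed over j, the terms form a geometric series in
    an n-th root of unity y, and y = 1 only for a = 0. *)
Lemma ind0_fourier (n : nat) (a : 'Z_n) : (1 < n)%N ->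
  ind R 0 a = \sum_(j < n) n%:R^-1 * cis (2 * pi / n%:R * j%:R) ^+ a.
Proof.
move=> n1; have n0 : n%:R != 0 :> R by rewrite pnatr_eq0 -lt0n ltnW.
have n0C : n%:R != 0 :> C by rewrite pnatr_eq0 -lt0n ltnW.
pose y : C := cis (2 * pi / n%:R * a%:R : R).
have yE (j : nat) : cis (2 * pi / n%:R * j%:R : R) ^+ a = y ^+ j.
  by rewrite /y !cisM_nat exprAC.
under eq_bigr do rewrite yE.
have yn : y ^+ n = 1 by apply: cis_root; exact: ltnW.
rewrite -mulr_sumr /ind; have [a0|a0] := eqVneq a 0.
  have -> : y = 1 by rewrite /y a0 mulr0 cis0.
  by under eq_bigr do rewrite expr1n; rewrite sumr_const card_ord mulVf.
have y1 : y != 1.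
  apply/eqP => /cis_eq1[m].
  have pi0 : 2 * pi != 0 :> R by rewrite mulf_neq0 ?pnatr_eq0// gt_eqF// pi_gt0.
  rewrite -mulrA => /(mulfI pi0)/eqP; rewrite mulrC -[_ == _](inj_eq (mulIf n0)) divfK//.
  have an : (a < n)%N by rewrite -{2}(Zp_cast n1) ltn_ord.
  have a_gt0 : (0 < a)%N by rewrite lt0n; apply: contra a0 => /eqP a0; apply/eqP/val_inj.
  rewrite -[a%:R]/(a%:Z%:~R) -[n%:R]/(n%:Z%:~R) -intrM eqr_int => /eqP.
  move: (nat_of_ord a) an a_gt0 => b bn b0.
  by case: m => [[|m]|m] e; nia.
have /eqP := subrX1 y n; rewrite yn subrr eq_sym mulf_eq0 subr_eq0 (negPf y1)/=.
by move=> /eqP->; rewrite mulr0.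
Qed.

(** The limiting phase (-1)^j is the value of the j-th character at n / 2, so multiplying the
    Fourier coefficients by it translates the point mass from 0 to n / 2. Being real, it is the
    limit for both signs of time. *)
Lemma Gfam_integer_pgst k (G : sgraph 'Z_(2 ^ k)) : (3 <= k)%N -> Gfam G ->
  integer_pgst G.
Proof.
case: k G => [|[|c]] G // c0 GG; rewrite !ltnS in c0.
set n := (2 ^ c.+2)%N in G GG *; pose alpha : R := 2 * pi / n%:R.
have n1 : (1 < n)%N by rewrite (@ltn_exp2l 2 0).
have n0 : n%:R != 0 :> R by rewrite pnatr_eq0 -lt0n ltnW.
have zn j : cis (alpha * j%:R) ^+ n = 1 by apply: cis_root; exact: ltnW.
have /choice[mu Gmu] (j : 'I_n) := Gfam_eigenf (c0 : (3 <= c.+2)%N) GG (zn j).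
(* The s-th time is chosen with accuracy 1 / (s + 1). *)
have Vs0 (s : nat) : 0 < s.+1%:R^-1 :> R by rewrite invr_gt0.
have /choice[m mP] (s : nat) := cycle_approx c0 (Vs0 s).
pose w (j : nat) : C := cis (2 * pi * (2 * cos (alpha * j%:R))).
have wm (j : 'I_n) : (fun s => w j ^+ m s) @ \oo --> ((-1) ^+ j : C).
  by apply: cvg_bound_inv => s; exact: mP.
have wmV (j : 'I_n) : (fun s => w j ^- m s) @ \oo --> ((-1) ^+ j : C).
  apply: cvg_bound_inv => s; rewrite -[X in _ - X]invr_sign dist_inv; first exact: mP.
    by rewrite normrX norm_cis expr1n.
  by rewrite normrX normrN1 expr1n.
pose v : 'Z_n := (2 ^ c.+1)%:R.
pose chi (j : nat) (a : 'Z_n) : C := n%:R^-1 * cis (alpha * j%:R) ^+ a.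
have ind0E : ind R 0 = fun a : 'Z_n => \sum_(j < n) chi j a.
  by apply/funext => a; exact: ind0_fourier.
have indvE (a : 'Z_n) : ind R v a = \sum_(j < n) (-1) ^+ j * chi j a.
  have -> : ind R v a = ind R 0 (a - v) by rewrite /ind subr_eq0.
  rewrite ind0E; apply: eq_bigr => j _.
  rewrite /chi (chiD n1 (zn j)) (chiN n1 (zn j)) (chi_nat n1 (zn j)).
  have -> : cis (alpha * j%:R) ^+ (2 ^ c.+1) = (-1) ^+ j :> C.
    rewrite !cisM_nat exprAC -cisM_nat (_ : alpha * _ = pi) ?cis_pi//.
    rewrite /alpha /n [in (2 ^ c.+2)%N]expnS natrM; field.
    by rewrite pnatr_eq0 expn_eq0.
  by rewrite invr_sign; ring.
have walkE (T : R) a : walk G T (ind R 0) a = \sum_(j < n)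
    cis (- (T * (2 * cos (alpha * j%:R) + (mu j)%:~R))) * chi j a.
  rewrite ind0E walk_sum; apply: eq_bigr => j _.
  by rewrite walkZ (walk_eigenf _ _ (Gmu j)) /chi; ring.
exists 0, v, (fun s => (m s)%:Z); split.
  rewrite eq_sym; apply/eqP => /(congr1 (@nat_of_ord _)).
  rewrite val_Zp_nat// modn_small ?ltn_exp2l//.
  by apply/eqP; rewrite /= expn_eq0.
move=> a; rewrite indvE; split.
  under eq_fun do rewrite walkE.
  apply: cvg_sum_fin => j; apply: cvgMr_tmp.
  under eq_fun do rewrite cisN cis_integer_time.
  exact: wmV.
under eq_fun do rewrite walkE.
apply: cvg_sum_fin => j; apply: cvgMr_tmp.
under eq_fun do rewrite mulNr opprK cis_integer_time.
exact: wm.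
Qed.

Lemma regular_Gfam k (G : sgraph 'Z_(2 ^ k)) : (3 <= k)%N -> Gfam G -> regular G.
Proof.
move=> k3 GG; apply/(regular_eigenf R).
have [|mu Gmu] := @Gfam_eigenf R k G 0 k3 GG; first by rewrite cis0 expr1n.
exists (2 * cos 0 + mu%:~R); rewrite (_ : (fun=> 1) = fun a : 'Z_(2 ^ k) => cis 0 ^+ a)//.
by apply/funext => a; rewrite cis0 expr1n.
Qed.

Lemma in_calG_integer_pgst (V : finType) (G : sgraph V) :
  in_calG G -> regular G /\ integer_pgst G.
Proof.
case=> k {}G k3 [GG|[H HH ->]]; first by split; [exact: regular_Gfam|exact: Gfam_integer_pgst].
have [d Hd] := regular_Gfam k3 HH; split; first exact: (regular_compl R Hd).
by apply: integer_pgst_compl; [exists d|exact: Gfam_integer_pgst].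
Qed.

Lemma cvg_mul_ind (V1 V2 : finType) (u1 : V1) (v2 : V2) (delta : nat -> C)
    (gamma : C) (y : nat -> V2 -> C) (p : V1 * V2) :
  delta @ \oo --> gamma -> (fun s => y s p.2) @ \oo --> ind R v2 p.2 ->
  (fun s => delta s * ind R u1 p.1 * y s p.2) @ \oo --> gamma * ind R (u1, v2) p.
Proof.
move=> dg yv; rewrite (_ : ind R (u1, v2) p = ind R u1 p.1 * ind R v2 p.2).
  rewrite mulrA.
  exact: (cvgM (cvgMr_tmp (b := ind R u1 p.1) dg) yv).
by case: p {yv} => p q; rewrite /ind xpair_eqE -natrM mulnb.
Qed.

End IntegerTimes.

(** * Transfer in Cartesian products and their complements *)

Theorem corollary2p5 (R : realType) (V1 V2 : finType)
    (G1 : sgraph V1) (G2 : sgraph V2)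
    (hG1 : exists u : V1, periodic_at G1 u (2 * pi : R))
    (hG2 : in_calG G2) :
  pgst R (cart_graph G1 G2) /\
  (regular G1 -> pgst R (compl_graph (cart_graph G1 G2))).
Proof.
have [u1 /periodic_walk[gamma [gamma1 Gu1]]] := hG1.
have [rG2 [u2 [v2 [m [uv2 Gm]]]]] := in_calG_integer_pgst R hG2.
have gamma0 : gamma != 0 by rewrite -normr_gt0 gamma1.
have normXz (n : int) : `|gamma ^ n| = 1.
  case: n => n; first by rewrite normrX gamma1 expr1n.
  by rewrite NegzE -exprnN normfV normrX gamma1 expr1n invr1.
have indE : ind R (u1, u2) = fun p => ind R u1 p.1 * ind R u2 p.2.
  by apply/funext => -[p q]; rewrite /ind xpair_eqE -natrM mulnb.
have walkE (n : int) p : walk (cart_graph G1 G2) (2 * pi * n%:~R) (ind R (u1, u2)) p =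
    gamma ^ n * ind R u1 p.1 * walk G2 (2 * pi * n%:~R) (ind R u2) p.2.
  by rewrite indE walk_cart (walk_eigenvector_exp n gamma0 Gu1).
have uv : (u1, u2) != (u1, v2) by rewrite xpair_eqE eqxx.
have subseq (x : nat -> complexField R) (phi : nat -> nat) (l : complexField R) :
    phi @ \oo --> \oo -> x @ \oo --> l -> (fun s => x (phi s)) @ \oo --> l.
  by move=> phiy xl; exact: (cvg_comp _ _ phiy xl).
split.
  (* The phases gamma^m need not converge, so a subsequence is taken; the transfer in [G2] persists
     along it. *)
  have [phi [delta [phiy delta1 md]]] :=
    unit_circle_subsequence (fun s => normXz (m s)).
  apply: (pgst_walk (t := fun s => 2 * pi * (m (phi s))%:~R) uv delta1) => p.
  under eq_fun do rewrite walkE.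
  exact: (@cvg_mul_ind R _ _ u1 v2 _ _ (fun s => walk G2 (2 * pi * (m (phi s))%:~R) (ind R u2))
    p md (subseq _ _ _ phiy (Gm p.2).1)).
(* The product is regular, so its complement runs backwards at these times: the phases are gamma^-m
   and the negative-time half of [Gm] applies. *)
move=> rG1; have [d Gd] := regular_cart R rG1 rG2.
have [phi [delta [phiy delta1 md]]] :=
  unit_circle_subsequence (fun s => normXz (- m s)).
apply: (pgst_walk (t := fun s => 2 * pi * (m (phi s))%:~R) uv delta1) => p.
have walkNE s : walk (compl_graph (cart_graph G1 G2)) (2 * pi * (m (phi s))%:~R)
    (ind R (u1, u2)) p = gamma ^ (- m (phi s)) * ind R u1 p.1 *
    walk G2 (- (2 * pi * (m (phi s))%:~R)) (ind R u2) p.2.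
  by rewrite (walk_compl Gd) -mulrN -intrN walkE.
under eq_fun do rewrite walkNE.
exact: (@cvg_mul_ind R _ _ u1 v2 _ _ (fun s => walk G2 (- (2 * pi * (m (phi s))%:~R)) (ind R u2))
  p md (subseq _ _ _ phiy (Gm p.2).2)).
Qed.
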